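(* Let $t\in\mathbb{Z}$, let $D(t)=t^6+4t^4+30t^3+5t^2+54t+245$, let $E_D$ be the elliptic curve $y^2=x^3+2D(t)x^2+163D(t)^2x+2205D(t)^3$ over $\mathbb{Q}$, and let $P$ be the point $\bigl(D(t)(t^4+2t^2+12t),\ D(t)^2(t^3+t+3)\bigr)$ on $E_D$. Assume that $D(t)$ is square-free. Then $P$ is a primitive point of $E_D(\mathbb{Q})$ if $|t|\geq 2216$. In particular, if $|t|\ge 2216$ and $\operatorname{rank}E_D(\mathbb{Q})=1$, then $E_D(\mathbb{Q})\simeq\langle P\rangle$.
   Context: $P$ is primitive (as an element of the Mordell–Weil group $E_D(\mathbb{Q})$) means that there is no point $R\in E_D(\mathbb{Q})$ and integer $m$ with $|m|\geq 2$ such that $P=mR$. $\langle P\rangle$ denotes the subgroup of $E_D(\mathbb{Q})$ generated by $P$. *)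

(* Defs.v *)
From HB Require Import structures.
From mathcomp Require Import all_boot all_order all_algebra.
From mathcomp Require Import zify ring.

Set Implicit Arguments.
Unset Strict Implicit.
Unset Printing Implicit Defensive.

Import Order.TTheory GRing.Theory Num.Theory.
Local Open Scope ring_scope.

Definition zindep (A : zmodType) (n : nat) (v : 'I_n -> A) : Prop :=
  forall c : 'I_n -> int, \sum_i v i *~ c i = 0 -> forall i, c i = 0.

(* The maximal number of Z-independent elements, i.e. dim_Q (A (x) Q). *)
Definition has_rank (A : zmodType) (r : nat) : Prop :=
  (exists v : 'I_r -> A, zindep v) /\
  (forall (n : nat) (v : 'I_n -> A), zindep v -> (n <= r)%N).

Definition primitive (A : zmodType) (P : A) : Prop :=
  ~ exists (R : A) (m : int), 2 <= `|m| /\ P = R *~ m.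

Definition subgroup (A : zmodType) (S : A -> Prop) : Prop :=
  S 0 /\ forall x y, S x -> S y -> S (x - y).

Definition generated (A : zmodType) (P : A) : A -> Prop :=
  fun Q => forall S : A -> Prop, subgroup S -> S P -> S Q.

Lemma generatedP (A : zmodType) (P Q : A) :
  generated P Q <-> exists n : int, Q = P *~ n.
Proof.
split=> [h|[n ->] S [S0 SB] SP].
  apply: (h (fun R => exists n : int, R = P *~ n)); last by exists 1; rewrite mulr1z.
  split=> [|_ _ [m ->] [n ->]]; first by exists 0; rewrite mulr0z.
  by exists (m - n); rewrite mulrzBr.
have SN x : S x -> S (- x) by move=> Sx; rewrite -sub0r; apply: SB.
have Sn m : S (P *+ m).
  elim: m => [|m ih] //; rewrite mulrS -[P *+ m]opprK.
  by apply: (SB) => //; apply: SN.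
by case: n => n; [exact: Sn|rewrite NegzE mulrNz; apply/SN/Sn].
Qed.

Definition isomorphic_to_subgroup (A B : zmodType) (S : B -> Prop) : Prop :=
  exists f : {additive A -> B},
    injective f /\ forall b, S b <-> exists a, f a = b.

Definition squarefree (n : int) : Prop :=
  forall d : int, (d ^+ 2 %| n)%Z -> `|d| = 1.

(* The curve y^2 = x^3 + a2 x^2 + a4 x + a6. *)
Record ellcurve (F : fieldType) := EllCurve {
  a2 : F; a4 : F; a6 : F;
  disc_neq0 : 16 * (a2 ^+ 2 * a4 ^+ 2 - 4 * a4 ^+ 3 - 4 * a2 ^+ 3 * a6
                    - 27 * a6 ^+ 2 + 18 * a2 * a4 * a6) != 0 }.

Definition on_curve (F : fieldType) (E : ellcurve F) (p : option (F * F)) :=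
  if p is Some (x, y)
  then y ^+ 2 == x ^+ 3 + a2 E * x ^+ 2 + a4 E * x + a6 E else true.

(* [None] is the point at infinity. *)
Record point (F : fieldType) (E : ellcurve F) :=
  Point { coords : option (F * F); _ : on_curve E coords }.

HB.instance Definition _ (F : fieldType) (E : ellcurve F) :=
  [isSub for @coords F E].
HB.instance Definition _ (F : fieldType) (E : ellcurve F) :=
  [Choice of point E by <:].

Section GroupLaw.
Variables (F : fieldType) (E : ellcurve F).
Local Notation a2 := (a2 E).
Local Notation a4 := (a4 E).
Local Notation a6 := (a6 E).

Definition neg_coords (p : option (F * F)) : option (F * F) :=
  if p is Some (x, y) then Some (x, - y) else None.

(* Chord-and-tangent law. *)
Definition add_coords (p q : option (F * F)) : option (F * F) :=
  match p, q with
  | None, _ => q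
  | _, None => p
  | Some (x1, y1), Some (x2, y2) =>
      if (x1 == x2) && (y1 == - y2) then None else
      let l := if x1 == x2 then (3 * x1 ^+ 2 + 2 * a2 * x1 + a4) / (2 * y1)
               else (y2 - y1) / (x2 - x1) in
      let x3 := l ^+ 2 - a2 - x1 - x2 in
      Some (x3, - (y1 + l * (x3 - x1)))
  end.

Lemma two_neq0 : (2 : F) != 0.
Proof.
apply: contraNneq (disc_neq0 E) => h2.
have -> : (16 : F) = 2 * 8 by ring.
by rewrite h2 !mul0r.
Qed.

Lemma neg_on_curve p : on_curve E p -> on_curve E (neg_coords p).
Proof. by case: p => [[x y]|] //=; rewrite sqrrN. Qed.

(* In the conclusion, the last three equations say that
   f(T) - (m + l T)^2 = (T - x1) (T - x2) (T - x3). *)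
Lemma add_lineP x1 y1 x2 y2 : on_curve E (Some (x1, y1)) ->
  on_curve E (Some (x2, y2)) -> ~~ ((x1 == x2) && (y1 == - y2)) ->
  exists l x3, let m := y1 - l * x1 in
  [/\ add_coords (Some (x1, y1)) (Some (x2, y2)) = Some (x3, - (m + l * x3)),
      y2 = m + l * x2,
      x1 != x2 \/ [/\ x1 = x2, y1 = y2 & y1 != 0] &
      [/\ a2 = l ^+ 2 - x1 - x2 - x3,
      a4 = 2 * l * m + x1 * x2 + x1 * x3 + x2 * x3 &
      a6 = m ^+ 2 - x1 * x2 * x3]].
Proof.
move=> /eqP e1 /eqP e2 hn; rewrite /add_coords (negbTE hn).
set l := if _ then _ else _; set x3 := l ^+ 2 - _ - _ - _.
exists l, x3; cbv zeta; set m := y1 - l * x1.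
have ha2 : a2 = l ^+ 2 - x1 - x2 - x3 by rewrite /x3; ring.
suff [h1 h2 h3] : [/\ y2 = m + l * x2,
  x1 != x2 \/ [/\ x1 = x2, y1 = y2 & y1 != 0] &
  a4 = 2 * l * m + x1 * x2 + x1 * x3 + x2 * x3].
  split; [by rewrite /m; congr (Some (_, - _)); ring|exact: h1|exact: h2|].
  split; [exact: ha2|exact: h3|].
  have -> : a6 = y1 ^+ 2 - (x1 ^+ 3 + a2 * x1 ^+ 2 + a4 * x1) by rewrite e1; ring.
  by rewrite ha2 h3 /m; ring.
move: ha2; rewrite /m; clearbody x3; rewrite /l {l m}.
have [ex|nx] := eqVneq x1 x2 => ha2.
  subst x2; move: hn; rewrite eqxx /= => hn.
  have ey : y1 = y2.
    have /eqP : (y1 - y2) * (y1 + y2) = 0.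
      transitivity (y1 ^+ 2 - y2 ^+ 2); first by ring.
      by rewrite e1 e2 subrr.
    by rewrite mulf_eq0 subr_eq0 addr_eq0 (negbTE hn) orbF => /eqP.
  have y0 : y1 != 0.
    by apply: contraNneq hn => y0; rewrite -ey y0 oppr0.
  have t0 := two_neq0; subst y2.
  set l := _ / _ in ha2 *.
  have hl : l * (2 * y1) = 3 * x1 ^+ 2 + 2 * a2 * x1 + a4.
    by rewrite /l divfK // mulf_neq0.
  split; [by ring|by right|].
  have -> : a4 = l * (2 * y1) - 3 * x1 ^+ 2 - 2 * a2 * x1 by rewrite hl; ring.
  by rewrite ha2; ring.
have d0 : x2 - x1 != 0 by rewrite subr_eq0 eq_sym.
set l := _ / _ in ha2 *.
have hl : y2 = y1 + l * (x2 - x1) by rewrite /l divfK //; ring.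
split; [by rewrite hl; ring|by left|].
apply: (mulfI d0).
have -> : (x2 - x1) * a4 = (y2 ^+ 2 - y1 ^+ 2) - (x2 ^+ 3 - x1 ^+ 3)
   - a2 * (x2 ^+ 2 - x1 ^+ 2) by rewrite e1 e2; ring.
by rewrite ha2 hl; ring.
Qed.

Lemma add_on_curve p q :
  on_curve E p -> on_curve E q -> on_curve E (add_coords p q).
Proof.
case: p q => [[x1 y1]|] [[x2 y2]|] // h1 h2.
have [h|h] := boolP ((x1 == x2) && (y1 == - y2)).
  by rewrite /add_coords h.
have [l [x3 [-> _ _ [e2 e4 e6]]]] := add_lineP h1 h2 h.
by rewrite /on_curve e2 e4 e6; apply/eqP; ring.
Qed.


Let f : {poly F} := 'X^3 + a2%:P * 'X^2 + a4%:P * 'X + a6%:P.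

(* Associativity is proved through ideal classes of the coordinate ring:
   [(p, q)] stands for [p + q Y] in F[X, Y] / (Y^2 - f). *)
Definition cring : Type := ({poly F} * {poly F})%type.
HB.instance Definition _ := GRing.Zmodule.copy cring ({poly F} * {poly F})%type.

Definition cring_mul (z w : cring) : cring :=
  (z.1 * w.1 + z.2 * w.2 * f, z.1 * w.2 + z.2 * w.1).

Fact cring_mulA : associative cring_mul.
Proof. by move=> u v w; congr pair => /=; ring. Qed.
Fact cring_mulC : commutative cring_mul.
Proof. by move=> u v; congr pair => /=; ring. Qed.
Fact cring_mul1 : left_id ((1, 0) : cring) cring_mul.
Proof. by case=> p q; congr pair => /=; ring. Qed.
Fact cring_mulD : left_distributive cring_mul +%R.
Proof. by move=> u v w; congr pair => /=; ring. Qed.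
Fact cring_1_neq0 : ((1, 0) : cring) != 0.
Proof. by apply/eqP => -[/eqP]; rewrite oner_eq0. Qed.
HB.instance Definition _ := GRing.Zmodule_isComNzRing.Build cring
  cring_mulA cring_mulC cring_mul1 cring_mulD cring_1_neq0.

Let k (a : F) : cring := (a%:P, 0).
Fact k_zmod : zmod_morphism k.
Proof. by move=> a b; congr pair; rewrite /= ?polyCB ?subrr. Qed.
Fact k_monoid : monoid_morphism k.
Proof.
split=> // a b; congr pair; rewrite /= ?polyCM; ring.
Qed.
HB.instance Definition _ := GRing.isZmodMorphism.Build F cring k k_zmod.
HB.instance Definition _ := GRing.isMonoidMorphism.Build F cring k k_monoid.
Let X : cring := ('X, 0).
Let Y : cring := (0, 1).

Lemma YY : Y ^+ 2 = X ^+ 3 + k a2 * X ^+ 2 + k a4 * X + k a6.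
Proof. by rewrite !exprS !expr0 !mulr1; congr pair => /=; rewrite /f; ring. Qed.

Let N (z : cring) : {poly F} := z.1 ^+ 2 - z.2 ^+ 2 * f.
Lemma NM z w : N (z * w) = N z * N w.
Proof. by rewrite /N /=; ring. Qed.

Lemma size_f : size f = 4.
Proof.
rewrite /f -!addrA size_polyDl size_polyXn //.
rewrite (leq_ltn_trans (size_polyD _ _)) // gtn_max.
rewrite mul_polyC (leq_ltn_trans (size_scale_leq _ _)) ?size_polyXn //=.
rewrite (leq_ltn_trans (size_polyD _ _)) // gtn_max.
rewrite mul_polyC (leq_ltn_trans (size_scale_leq _ _)) ?size_polyX //=.
by rewrite (leq_ltn_trans (size_polyC_leq1 _)).
Qed.

Lemma size_N z : z.2 != 0 -> (4 <= size (N z))%N.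
Proof.
case: z => p q /= q0; rewrite /N /=.
have f0 : f != 0 by rewrite -size_poly_eq0 size_f.
have sq : size (q ^+ 2 * f) = (size q).*2.+2.
  rewrite size_mul ?expf_neq0 // size_f expr2 size_mul //.
  by move: q0; rewrite -size_poly_gt0; case: (size q) => // n _; lia.
have sq4 : (4 <= size (q ^+ 2 * f)%R)%N.
  by move: q0; rewrite sq -size_poly_gt0; lia.
have [->|p0] := eqVneq p 0; first by rewrite expr0n sub0r size_polyN.
have sp : size (p ^+ 2) = ((size p).*2.-1)%N.
  by rewrite expr2 size_mul // addnn.
have := p0; rewrite -size_poly_gt0 => p1.
have [lt|ge] := ltnP (size (p ^+ 2)%R) (size (q ^+ 2 * f)%R).
  by rewrite addrC size_polyDl size_polyN.
have lt : (size (q ^+ 2 * f)%R < size (p ^+ 2)%R)%N.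
  by move: ge p1; rewrite sp sq; move: (size p) (size q) => a b; lia.
by rewrite size_polyDl ?size_polyN // (leq_trans sq4 (ltnW lt)).
Qed.

Lemma N_neq0 z : z != 0 -> N z != 0.
Proof.
move=> z0; have [e|/size_N h] := eqVneq z.2 0; last first.
  by rewrite -size_poly_gt0 (leq_trans _ h).
rewrite /N e expr0n mul0r subr0 expf_neq0 //.
by apply: contra_neq z0; move: e; case: z => p q /= -> ->.
Qed.

Lemma cring_mulf_neq0 (z w : cring) : z != 0 -> w != 0 -> z * w != 0.
Proof.
move=> /N_neq0 hz /N_neq0 hw.
have : N (z * w) != 0 by rewrite NM mulf_neq0.
by apply: contra_neq => ->; rewrite /N expr0n /= mul0r subr0.
Qed.

Lemma cring_mulI (z v w : cring) : z != 0 -> z * v = z * w -> v = w.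
Proof.
move=> z0 e; apply/eqP; rewrite -subr_eq0; apply: contraT => d0.
have := cring_mulf_neq0 z0 d0.
by rewrite mulrBr e subrr eqxx.
Qed.

Definition is_ideal (I : cring -> Prop) :=
  I 0 /\ forall a x y, I x -> I y -> I (a * x + y).

(* The product ideal. *)
Inductive iprod (I J : cring -> Prop) : cring -> Prop :=
| iprod0 : iprod I J 0
| iprodD i j z : I i -> J j -> iprod I J z -> iprod I J (i * j + z).

Lemma iprod_in (I J : cring -> Prop) i j : I i -> J j -> iprod I J (i * j).
Proof. by move=> hi hj; rewrite -[i * j]addr0; apply: iprodD => //; left. Qed.

Lemma iprod_ideal I J : is_ideal I -> is_ideal (iprod I J).
Proof.
move=> [I0 hI]; split=> [|a x y hx hy]; first by left.
elim: hx => {x} [|i j z hi hj _ ih]; first by rewrite mulr0 add0r.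
have -> : a * (i * j + z) + y = (a * i) * j + (a * z + y) by ring.
by apply: iprodD => //; rewrite -[a * i]addr0; apply: (hI).
Qed.

Lemma iprod_min (I J K : cring -> Prop) : is_ideal K ->
  (forall i j, I i -> J j -> K (i * j)) -> forall z, iprod I J z -> K z.
Proof.
move=> [K0 hK] h z; elim=> // i j {}z hi hj _ Kz.
by rewrite -[i * j]mul1r; apply: hK => //; apply: h.
Qed.

(* Equality of ideal classes. *)
Definition ieq (I J : cring -> Prop) := exists a b, [/\ a != 0, b != 0,
  forall i, I i -> exists2 j, J j & a * i = b * j &
  forall j, J j -> exists2 i, I i & a * i = b * j].

Lemma ieq_sub (I J : cring -> Prop) :
  (forall z, I z -> J z) -> (forall z, J z -> I z) -> ieq I J.
Proof.
move=> h1 h2; exists 1, 1; split; rewrite ?oner_neq0 // => i hi; exists i; auto.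
Qed.

Lemma ieq_sym I J : ieq I J -> ieq J I.
Proof.
move=> [a [b [a0 b0 h1 h2]]]; exists b, a; split=> //.
  by move=> i /h2 [j hj e]; exists j.
by move=> i /h1 [j hj e]; exists j.
Qed.

Lemma ieq_trans J I K : ieq I J -> ieq J K -> ieq I K.
Proof.
move=> [a [b [a0 b0 h1 h2]]] [c [d [c0 d0 h3 h4]]].
exists (a * c), (b * d); split; rewrite ?cring_mulf_neq0 //.
  move=> i /h1 [j /h3 [l hl e2] e1]; exists l => //.
  by rewrite (mulrC a c) -(mulrA c a i) e1 (mulrCA c b j) e2 mulrA.
move=> l /h4 [j /h2 [i hi e1] e2]; exists i => //.
by rewrite (mulrC a c) -(mulrA c a i) e1 (mulrCA c b j) e2 mulrA.
Qed.

Lemma ieq_prod I I' J : ieq I I' -> ieq (iprod I J) (iprod I' J).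
Proof.
move=> [a [b [a0 b0 h1 h2]]]; exists a, b; split=> // z.
  elim=> [|i j {}z /h1 [i' hi' e] hj _ [z' hz' e']].
    by exists 0; rewrite ?mulr0 //; left.
  by exists (i' * j + z'); [right|rewrite !mulrDr !mulrA e e'].
elim=> [|i j {}z /h2 [i' hi' e] hj _ [z' hz' e']].
  by exists 0; rewrite ?mulr0 //; left.
by exists (i' * j + z'); [right|rewrite !mulrDr !mulrA e e'].
Qed.

Lemma iprodC I J : is_ideal I -> is_ideal J -> ieq (iprod I J) (iprod J I).
Proof.
move=> hI hJ; apply: ieq_sub; apply: iprod_min; try exact: iprod_ideal.
  by move=> i j hi hj; rewrite mulrC; apply: iprod_in.
by move=> i j hi hj; rewrite mulrC; apply: iprod_in.
Qed.

Lemma iprodA I J K : is_ideal I -> is_ideal J -> is_ideal K ->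
  ieq (iprod (iprod I J) K) (iprod I (iprod J K)).
Proof.
move=> hI hJ hK.
have hL := iprod_ideal (iprod J K) hI.
have hR := iprod_ideal K (iprod_ideal J hI).
apply: ieq_sub; apply: iprod_min => //.
  move=> z l hz hl; elim: hz => [|i j {}z hi hj _ ih]; first by rewrite mul0r; left.
  have -> : (i * j + z) * l = i * (j * l) + z * l by ring.
  by apply: iprodD => //; apply: iprod_in.
move=> l z hl; elim=> [|i j {}z hi hj ih]; first by rewrite mulr0; left.
have -> : l * (i * j + z) = (l * i) * j + l * z by ring.
by apply: iprodD => //; apply: iprod_in.
Qed.

(* The ideal of functions vanishing at an affine point. *)
Definition ipt (p : option (F * F)) (z : cring) : Prop :=
  if p is Some (x, y) then exists c d, z = c * (X - k x) + d * (Y - k y)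
  else True.

Lemma ipt_ideal p : is_ideal (ipt p).
Proof.
case: p => [[x y]|] //; split=> [|a u v [c [d ->]] [c' [d' ->]]].
  by exists 0, 0; ring.
by exists (a * c + c'), (a * d + d'); ring.
Qed.

Lemma ipt_neg x y : on_curve E (Some (x, y)) ->
  ieq (iprod (ipt (Some (x, y))) (ipt (Some (x, - y)))) (ipt None).
Proof.
move=> /eqP e.
have e6 : a6 = y ^+ 2 - x ^+ 3 - a2 * x ^+ 2 - a4 * x by rewrite e; ring.
have hY := YY; rewrite e6 in hY.
set I := iprod _ _.
have [I0 hI] : is_ideal I by apply/iprod_ideal/ipt_ideal.
have hI1 a z : I z -> I (a * z) by move=> hz; rewrite -[a * z]addr0; apply: (hI).
pose U := X - k x.
have m1 : ipt (Some (x, y)) U by exists 1, 0; rewrite /U; ring.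
have m2 : ipt (Some (x, y)) (Y - k y) by exists 0, 1; ring.
have m3 : ipt (Some (x, - y)) U by exists 1, 0; rewrite /U; ring.
have m4 : ipt (Some (x, - y)) (Y + k y) by exists 0, 1; ring.
exists 1, U; split; rewrite ?oner_neq0 //.
- by apply/eqP => -[/eqP]; rewrite subr_eq0 /= => /eqP h;
     have := size_polyX F; rewrite h size_polyC; case: eqP.
- apply: iprod_min.
    split=> [|a u v [c _ h1] [d _ h2]]; first by exists 0; rewrite ?mulr0.
    by exists (a * c + d); rewrite // mulrDr mulrCA h1 h2; ring.
  move=> i j [c1 [d1 ->]] [c2 [d2 ->]].
  exists (c1 * c2 * (X - k x) + c1 * d2 * (Y + k y) + d1 * c2 * (Y - k y) +
    d1 * d2 * (X ^+ 2 + X * k x + k x ^+ 2 + k a2 * (X + k x) + k a4)) => //.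
  by rewrite /U; ring: hY.
move=> j _; exists (U * j); last by rewrite mul1r.
rewrite mulrC; apply: (hI1).
have [y0|y0] := eqVneq y 0; last first.
  have y2 : 2 * y != 0 by rewrite mulf_neq0 ?two_neq0.
  have -> : U = k (2 * y)^-1 * (1 * (U * (Y + k y)) + (- 1) * ((Y - k y) * U)).
    transitivity (k ((2 * y)^-1 * (2 * y)) * U); last by rewrite /U; ring.
    by rewrite mulVf // rmorph1 mul1r.
  by apply: (hI1); apply: (hI); [|apply: (hI1)]; apply: iprod_in.
pose g := 3 * x ^+ 2 + 2 * a2 * x + a4.
have g0 : g != 0.
  apply: contraNneq (disc_neq0 E) => g0; rewrite e6 y0.
  have -> : a4 = 0 - (3 * x ^+ 2 + 2 * a2 * x) by rewrite -g0 /g; ring.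
  by apply/eqP; ring.
have -> : U = k g^-1 * (1 * ((Y - k y) * (Y + k y)) +
                 - (X + 2 * k x + k a2) * (U * U)).
  transitivity (k (g^-1 * g) * U); first by rewrite mulVf // rmorph1 mul1r.
  by rewrite /U /g; ring: hY.
by apply: (hI1); apply: (hI); [|apply: (hI1)]; apply: iprod_in.
Qed.

Lemma ipt_add p q : on_curve E p -> on_curve E q ->
  ieq (iprod (ipt p) (ipt q)) (ipt (add_coords p q)).
Proof.
have h0 r : ieq (iprod (ipt None) (ipt r)) (ipt r).
  have [r0 hr] := ipt_ideal r.
  apply: ieq_sub => [|z hz]; last by rewrite -[z]mul1r; apply: iprod_in.
  by apply: iprod_min => // i j _ hj; rewrite -[i * j]addr0; apply: hr.
case: p => [[x1 y1]|] h1; last by move=> _; apply: h0.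
case: q => [[x2 y2]|] h2; last first.
  by apply: (ieq_trans (iprodC _ _)); [exact: ipt_ideal..|exact: h0].
have [h|h] := boolP ((x1 == x2) && (y1 == - y2)).
  rewrite /add_coords h.
  case/andP: h => /eqP ex /eqP ey.
  have -> : Some (x2, y2) = Some (x1, - y1) by rewrite ex ey opprK.
  exact: ipt_neg.
have [l [x3 [-> hy2 alt [e2 e4 e6]]]] := add_lineP h1 h2 h.
set m := y1 - l * x1 in hy2 e4 e6 *.
have hy1 : y1 = m + l * x1 by rewrite /m; ring.
clearbody m.
have hY := YY; rewrite e2 e4 e6 in hY.
pose L := Y - k m - k l * X.
set I := iprod _ _.
have hid : is_ideal I by apply/iprod_ideal/ipt_ideal.
have [I0 hI] := hid.
have hI1 a z : I z -> I (a * z) by move=> hz; rewrite -[a * z]addr0; apply: (hI).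
pose U1 := X - k x1; pose U2 := X - k x2; pose U3 := X - k x3.
have u1 : ipt (Some (x1, y1)) U1 by exists 1, 0; rewrite /U1; ring.
have u2 : ipt (Some (x2, y2)) U2 by exists 1, 0; rewrite /U2; ring.
have l1 : ipt (Some (x1, y1)) L by exists (- k l), 1; rewrite /L hy1; ring.
have l2 : ipt (Some (x2, y2)) L by exists (- k l), 1; rewrite /L hy2; ring.
have IL : I L.
  case: alt => [nx|[ex ey y0]].
    have d0 : x2 - x1 != 0 by rewrite subr_eq0 eq_sym.
    have -> : L = k (x2 - x1)^-1 * (1 * (U1 * L) + (- 1) * (L * U2)).
      transitivity (k ((x2 - x1)^-1 * (x2 - x1)) * L).
        by rewrite mulVf // rmorph1 mul1r.
      by rewrite /U1 /U2; ring.
    by apply: (hI1); apply: (hI); [|apply: (hI1)]; apply: iprod_in.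
  have y2' : 2 * y1 != 0 by rewrite mulf_neq0 ?two_neq0.
  have -> : L = k (2 * y1)^-1 *
      (U3 * (U1 * U2) + ((- 2 * k l) * (L * U2) + (- 1) * (L * L))).
    transitivity (k ((2 * y1)^-1 * (2 * y1)) * L).
      by rewrite mulVf // rmorph1 mul1r.
    by rewrite hy1 /U1 /U2 /U3 /L ex; rewrite ex in hY; ring: hY.
  apply: (hI1); apply: (hI); first exact: iprod_in.
  by apply: (hI); [|apply: (hI1)]; apply: iprod_in.
exists U3, L; split.
- by apply/eqP => -[/eqP]; rewrite subr_eq0 /= => /eqP h';
     have := size_polyX F; rewrite h' size_polyC; case: eqP.
- by apply/eqP => -[_ /eqP]; rewrite /= !mul0r mulr0 !addr0 !subr0 oner_eq0.
- apply: iprod_min.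
    have [J0 hJ] := ipt_ideal (Some (x3, - (m + l * x3))).
    split=> [|a u v [c hc h3] [d hd h4]]; first by exists 0; rewrite ?mulr0.
    by exists (a * c + d); [apply: hJ|rewrite mulrDr mulrCA h3 h4; ring].
  move=> i j [c1 [d1 ->]] [c2 [d2 ->]].
  pose M := c1 * c2 + k l * (c1 * d2 + d1 * c2) + k l ^+ 2 * d1 * d2.
  pose C := c1 * d2 * U1 + d1 * c2 * U2 + d1 * d2 * (L + k l * (U1 + U2)).
  exists ((C + k l * M) * U3 + M * (Y - k (- (m + l * x3)))).
    by exists (C + k l * M), M.
  by rewrite hy1 hy2 /M /C /U1 /U2 /U3 /L; ring: hY.
move=> j [c [d ->]]; exists (c * L + d * (1 * (U1 * U2) + - k l * L)).
  apply: (hI) => //; apply: (hI1); apply: (hI); first exact: iprod_in.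
  exact: hI1.
by rewrite /U1 /U2 /U3 /L; ring: hY.
Qed.

Lemma ipt_nprincipal p : on_curve E p -> ieq (ipt p) (ipt None) -> p = None.
Proof.
case: p => [[x y]|] // /eqP e [a [b [a0 b0 h1 h2]]]; exfalso.
have [g [c [d hg]] eg] := h2 1 I.
have gdiv z : ipt (Some (x, y)) z -> exists w, z = g * w.
  move=> /h1 [w _ ew]; exists w; apply: (cring_mulI a0).
  by rewrite ew mulrA eg mulr1.
have [w1 ew1] : exists w, X - k x = g * w by apply: gdiv; exists 1, 0; ring.
have [w2 ew2] : exists w, Y - k y = g * w by apply: gdiv; exists 0, 1; ring.
have g2 : g.2 = 0.
  apply/eqP; apply: contraT => /size_N hs.
  have := congr1 N ew1; rewrite NM => eN.
  have eN' : ('X - x%:P) ^+ 2 = N g * N w1 by rewrite -eN /N /= subr0; ring.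
  have n0 : N g * N w1 != 0 by rewrite -eN' expf_neq0 ?polyXsubC_eq0.
  have := congr1 (fun p : {poly F} => size p) eN'.
  rewrite size_exp_XsubC size_mul; last 2 first.
  - by apply: contra_neq n0 => ->; rewrite mul0r.
  - by apply: contra_neq n0 => ->; rewrite mulr0.
  have : (0 < size (N w1))%N.
    by rewrite size_poly_gt0; apply: contra_neq n0 => ->; rewrite mulr0.
  by move: hs; move: (size (N g)) (size (N w1)) => u v; lia.
have /= := congr1 snd ew2; rewrite g2 mul0r addr0 subr0 => u.
have /(congr1 (horner^~ x)) := u; rewrite hornerM hornerC.
have := congr1 (fun z : cring => z.1.[x]) hg.
have := congr1 (fun z : cring => z.2.[x]) hg.
rewrite /= g2 /f !hornerE /=.
move=> q1 q2 q3.
have hd : d.1.[x] = d.2.[x] * y.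
  by apply/eqP; rewrite -subr_eq0 q1; apply/eqP; ring.
have g0 : g.1.[x] = d.2.[x] * (x ^+ 3 + a2 * x ^+ 2 + a4 * x + a6 - y ^+ 2).
  by rewrite q2 hd; ring.
by move/eqP: q3; rewrite g0 e subrr mulr0 mul0r oner_eq0.
Qed.

Definition zero_point : point E := @Point F E None isT.
Definition neg_point (p : point E) : point E := Point (neg_on_curve (valP p)).
Definition add_point (p q : point E) : point E :=
  Point (add_on_curve (valP p) (valP q)).

Let ip (p : point E) := ipt (coords p).
Lemma ip_ideal p : is_ideal (ip p). Proof. exact: ipt_ideal. Qed.
Lemma ip_add p q : ieq (iprod (ip p) (ip q)) (ip (add_point p q)).
Proof. exact: ipt_add (valP p) (valP q). Qed.

Lemma add_point0 : left_id zero_point add_point.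
Proof. by move=> p; apply: val_inj. Qed.

Lemma add_pointN : left_inverse zero_point neg_point add_point.
Proof.
by move=> [[[x y]|] h]; apply: val_inj; rewrite //= !eqxx.
Qed.

Lemma ip_inj p q : ieq (ip p) (ip q) -> p = q.
Proof.
move=> h; have := ieq_trans (ieq_prod (ip (neg_point q)) h)
  (ieq_trans (iprodC (ip_ideal _) (ip_ideal _)) (ip_add _ _)).
rewrite add_pointN => h'.
have := ipt_nprincipal (valP _) (ieq_trans (ieq_sym (ip_add _ _)) h').
case: p q {h h'} => [[[x1 y1]|] h1] [[[x2 y2]|] h2] //= h;
  apply: val_inj => //=; move: h.
by rewrite opprK; case: ifP => // /andP[/eqP -> /eqP ->].
Qed.

Lemma add_pointC : commutative add_point.
Proof.
move=> p q; apply: ip_inj.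
exact: ieq_trans (ieq_sym (ip_add _ _))
  (ieq_trans (iprodC (ip_ideal _) (ip_ideal _)) (ip_add _ _)).
Qed.

Lemma add_pointA : associative add_point.
Proof.
move=> p q r; apply: ip_inj; apply: ieq_sym.
apply: ieq_trans (ieq_sym (ip_add _ _)) _.
apply: ieq_trans (ieq_prod _ (ieq_sym (ip_add _ _))) _.
apply: ieq_trans (iprodA (ip_ideal _) (ip_ideal _) (ip_ideal _)) _.
apply: ieq_trans (iprodC (ip_ideal _) (iprod_ideal _ (ip_ideal _))) _.
apply: ieq_trans (ieq_prod _ (ip_add _ _)) _.
by apply: ieq_trans (ip_add _ _) _; rewrite add_pointC; apply: ieq_sub.
Qed.

End GroupLaw.

HB.instance Definition _ (F : fieldType) (E : ellcurve F) :=
  GRing.isZmodule.Build (point E)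
    (@add_pointA F E) (@add_pointC F E) (@add_point0 F E) (@add_pointN F E).

Definition Dpoly (t : int) : int :=
  t ^+ 6 + 4 * t ^+ 4 + 30 * t ^+ 3 + 5 * t ^+ 2 + 54 * t + 245.

(* [Dpoly t] is always odd, so no hypothesis is needed for [ED t] below to be
   an elliptic curve. *)
Lemma Dpoly_neq0 (t : int) : Dpoly t != 0.
Proof.
have [s [r [-> hr]]] : exists s r : int, t = 2 * s + r /\ (r = 0 \/ r = 1).
  by exists (t %/ 2)%Z, (t %% 2)%Z; lia.
have [w ->] : exists w : int, Dpoly (2 * s + r) = 2 * w + 1.
  case: hr => ->.
    exists (32 * s ^+ 6 + 32 * s ^+ 4 + 120 * s ^+ 3 + 10 * s ^+ 2 + 54 * s + 122).
    by rewrite /Dpoly; ring.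
  pose u : int := 2 * s + 1.
  exists (32 * s ^+ 6 + 96 * s ^+ 5 + 120 * s ^+ 4 + 80 * s ^+ 3 + 30 * s ^+ 2 + 6 * s
    + 2 * u ^+ 4 + 15 * u ^+ 3 + 5 * (2 * s ^+ 2 + 2 * s) + 27 * u + 125).
  by rewrite /Dpoly /u; ring.
lia.
Qed.

Lemma ED_disc (F : numFieldType) (d : F) : d != 0 ->
  16 * ((2 * d) ^+ 2 * (163 * d ^+ 2) ^+ 2 - 4 * (163 * d ^+ 2) ^+ 3
        - 4 * (2 * d) ^+ 3 * (2205 * d ^+ 3) - 27 * (2205 * d ^+ 3) ^+ 2
        + 18 * (2 * d) * (163 * d ^+ 2) * (2205 * d ^+ 3)) != 0.
Proof.
move=> d0; set z := (X in X != 0).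
have -> : z = - (12 ^+ 2 * 247 ^+ 3 * d ^+ 6) by rewrite /z; ring.
by rewrite oppr_eq0 !mulf_neq0 ?expf_neq0 ?pnatr_eq0.
Qed.

Lemma DpolyQ_neq0 (t : int) : (Dpoly t)%:~R != 0 :> rat.
Proof. by rewrite intr_eq0 Dpoly_neq0. Qed.

Definition ED (t : int) : ellcurve rat :=
  let D : rat := (Dpoly t)%:~R in
  @EllCurve rat (2 * D) (163 * D ^+ 2) (2205 * D ^+ 3)
    (ED_disc (DpolyQ_neq0 t)).

Definition PD_coords (t : int) : option (rat * rat) :=
  let D : rat := (Dpoly t)%:~R in let t : rat := t%:~R in
  Some (D * (t ^+ 4 + 2 * t ^+ 2 + 12 * t), D ^+ 2 * (t ^+ 3 + t + 3)).

Lemma PD_identity (F : fieldType) (t D : F) :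
  D = t ^+ 6 + 4 * t ^+ 4 + 30 * t ^+ 3 + 5 * t ^+ 2 + 54 * t + 245 ->
  let x := D * (t ^+ 4 + 2 * t ^+ 2 + 12 * t) in
  (D ^+ 2 * (t ^+ 3 + t + 3)) ^+ 2 =
  x ^+ 3 + 2 * D * x ^+ 2 + 163 * D ^+ 2 * x + 2205 * D ^+ 3.
Proof.
move=> e x.
have -> : (D ^+ 2 * (t ^+ 3 + t + 3)) ^+ 2 =
  D ^+ 3 * (D * (t ^+ 3 + t + 3) ^+ 2) by ring.
by rewrite [D * (_ ^+ 2)](congr1 ( *%R^~ _) e) /x; ring.
Qed.

Lemma PD_on_curve (t : int) : on_curve (ED t) (PD_coords t).
Proof.
apply/eqP; apply: (@PD_identity rat t%:~R (Dpoly t)%:~R).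
by rewrite /Dpoly; ring.
Qed.

Definition PD (t : int) : point (ED t) := Point (PD_on_curve t).

(* Main.v *)
Require Import Defs.
From mathcomp Require Import all_boot all_order all_algebra.
From mathcomp Require Import zify ring lra.
From Stdlib Require Classical_Prop.
Set Implicit Arguments.
Unset Strict Implicit.
Unset Printing Implicit Defensive.
Import Order.TTheory GRing.Theory Num.Theory.
Local Open Scope ring_scope.

(** Write a point of the curve as (D x, D^2 y).  Then D y^2 = f(x), where
    f(x) = x^3 + 2 x^2 + 163 x + 2205 does not depend on t, and doubling acts
    on x through a fixed rational function.  Measure a point by
    H = max(|p|, 10 q), where x = p/q in lowest terms, and set H = 1 at
    infinity.  The proof plays two facts against each other.

    First, H(P) is about t^4, since x(P) = t^4 + 2 t^2 + 12 t is an integer.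

    Second, every nonzero Q has H(2Q) >= 10 D / 2223, which is of order t^6
    ([rat_height_dbl_twist]).  As D is square-free, D y^2 = f(x) gives
    D w^2 = q F(p, q) with w an integer and F the homogeneous form of f, and
    w is nonzero because f has no rational root.  So 4 D w^2 is a denominator
    of x(2Q), and only the cancellation k has to be controlled.  It divides
    36 * 247^3 ([dvd_dbl]); moreover if 13 or 19 divides k, then x reduces to
    the node of f modulo that prime l, hence l^2 divides F(p, q) and l divides
    w ([dvd_cubic_node]).  This gives k <= 36 * 247 * w^2, which is
    [dvd_dbl_square].

    Up to bounded factors, Q |-> m Q raises heights to the power m^2.
    Hence P = m Q with |m| >= 2 would force H(2Q), whose logarithm is about
    4 log H(Q), to be at most H(P) up to a constant, and t^6 would be at most
    a constant times t^4.  The precise constant comes only from the duplication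
    inequalities H(Q)^4 <= 144 * 247^3 * H(2Q) and H(2Q) <= 23 H(Q)^4
    ([rat_height_dbl_ge], [rat_height_dbl_le]): instead of forming a canonical
    height, [height_of_multiple] compares H(2^k m Q) with H(2^k Q) for large
    k, so that the constants of the parallelogram law disappear in the limit.

    The same estimate with P replaced by the point at infinity, of height 1,
    shows that the group has no torsion.  In a torsion-free group of rank one
    a Bezout argument shows that a primitive element is a generator. *)

(** * Heights of multiples in an abelian group *)

Lemma expr_unbounded (R : archiRealFieldType) (a K : R) :
  1 < a -> exists n, K < a ^+ n.
Proof.
move=> a1; have d0 : 0 < a - 1 by rewrite subr_gt0.
have bern n : 1 + (a - 1) *+ n <= a ^+ n.
  elim: n => [|n ih]; first by rewrite mulr0n addr0 expr0.
  rewrite exprS; have : a * (1 + (a - 1) *+ n) <= a * a ^+ n.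
    by rewrite ler_pM2l //; apply: lt_trans a1.
  apply: le_trans; have h : 0 <= (a - 1) *+ n by rewrite mulrn_wge0 // ltW.
  by rewrite mulrS; nra.
exists (Num.bound (`|K| / (a - 1))).
have := archi_boundP (divr_ge0 (normr_ge0 K) (ltW d0)).
rewrite ltr_pdivrMr // mulr_natl => h.
apply: lt_le_trans (bern _); apply: le_lt_trans (ler_norm K) _.
by apply: lt_le_trans h _; rewrite lerDr.
Qed.

(** A multiplicative height on an abelian group: the upper half of the
    parallelogram law and two-sided control of doubling are enough to compare
    the height of a point with the heights of its multiples.  The constants
    are kept separate because [height_of_multiple] depends on [c] and [C']
    but not on [C]. *)
Section HeightGrowth.
Variables (A : zmodType) (R : archiRealFieldType) (H : A -> R) (C c C' : R).
Hypotheses (C1 : 1 <= C) (c1 : 1 <= c) (C'0 : 0 < C').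
Hypothesis H1 : forall Q, 1 <= H Q.
Hypothesis HN : forall Q, H (- Q) = H Q.
Hypothesis Hpar : forall P Q, H (P + Q) * H (P - Q) <= C * (H P * H Q) ^+ 2.
Hypothesis Hdbl_ge : forall Q, H Q ^+ 4 <= c * H (Q *+ 2).
Hypothesis Hdbl_le : forall Q, H (Q *+ 2) <= C' * H Q ^+ 4.

Let ltW0 (x : R) : 0 < x -> 0 <= x. Proof. exact: ltW. Qed.
Let H0 Q : 0 < H Q. Proof. exact: lt_le_trans (H1 Q). Qed.

(** The upper inequality at P + Q and P - Q bounds H(2P) H(2Q), and doubling
    raises heights to the fourth power up to the factor [c]. *)
Lemma height_parallelogram_ge P Q :
  (H P * H Q) ^+ 2 <= c * C * (H (P + Q) * H (P - Q)).
Proof.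
have e1 : P + Q + (P - Q) = P *+ 2 by rewrite addrCA addrK mulr2n.
have e2 : P + Q - (P - Q) = Q *+ 2.
  by rewrite opprB addrC addrA subrK mulr2n.
have := Hpar (P + Q) (P - Q); rewrite e1 e2 => h.
have h1 := Hdbl_ge P; have h2 := Hdbl_ge Q.
have c0 : 0 < c by apply: lt_le_trans c1.
have C0 : 0 < C by apply: lt_le_trans C1.
have hl : 0 <= (H P * H Q) ^+ 2 by rewrite exprn_ge0 ?mulr_ge0 ?ltW.
have hr : 0 <= c * C * (H (P + Q) * H (P - Q)) by rewrite !mulr_ge0 ?ltW.
rewrite -(@ler_pXn2r _ 2) //.
have : (H P * H Q) ^+ 4 <= c ^+ 2 * (H (P *+ 2) * H (Q *+ 2)).
  rewrite exprMn; have -> : c ^+ 2 * (H (P *+ 2) * H (Q *+ 2)) =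
    (c * H (P *+ 2)) * (c * H (Q *+ 2)) by ring.
  by apply: ler_pM => //; rewrite exprn_ge0 // ltW.
move=> h4; rewrite -exprM; apply: (le_trans h4).
rewrite exprMn [(c * C) ^+ 2]exprMn -[leRHS]mulrA ler_pM2l ?exprn_gt0 //.
apply: (le_trans h); rewrite ler_wpM2r ?exprn_ge0 ?mulr_ge0 ?(ltW (H0 _)) //.
by rewrite expr2 ler_peMl // ltW.
Qed.

(** Induction on two consecutive multiples: both halves of the parallelogram
    law at (n+1) Q and Q determine H((n+2) Q) from H(n Q) and H((n+1) Q), as
    (n+2)^2 + n^2 = 2 (n+1)^2 + 2. *)
Lemma height_mulrn n : exists2 K, 0 < K &
  forall Q, H Q ^+ (n ^ 2) <= K * H (Q *+ n) /\ H (Q *+ n) <= K * H Q ^+ (n ^ 2).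
Proof.
have c0 : 0 < c by apply: lt_le_trans c1.
have C0 : 0 < C by apply: lt_le_trans C1.
suff [] : (exists2 K, 0 < K & forall Q, H Q ^+ (n ^ 2) <= K * H (Q *+ n) /\
     H (Q *+ n) <= K * H Q ^+ (n ^ 2)) /\
  (exists2 K, 0 < K & forall Q, H Q ^+ (n.+1 ^ 2) <= K * H (Q *+ n.+1) /\
     H (Q *+ n.+1) <= K * H Q ^+ (n.+1 ^ 2)) by [].
elim: n => [|n [[K K0 hK] [L L0 hL]]]; first split.
- exists (H 0) => // Q; rewrite !mulr0n expr0 mulr1; split=> //.
  by rewrite -[leLHS](mulr1 1) ler_pM.
- by exists 1 => // Q; rewrite !mulr1n expr1 mul1r.
split; first by exists L.
exists (c * C * K * L ^+ 2).
  by rewrite !mulr_gt0 ?exprn_gt0.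
move=> Q; have [k1 k2] := hK Q; have [l1 l2] := hL Q.
have hp := Hpar (Q *+ n.+1) Q; have hm := height_parallelogram_ge (Q *+ n.+1) Q.
have eB : Q *+ n.+1 - Q = Q *+ n by rewrite mulrSr addrK.
rewrite eB -mulrSr in hp hm.
have h0 := H0 Q; have hq0 := H0 (Q *+ n).
have b0 := H0 (Q *+ n.+1); have d0 := H0 (Q *+ n.+2).
have hpow k : 0 < H Q ^+ k by rewrite exprn_gt0.
set h := H Q in h0 hpow *; set a := H (Q *+ n) in k1 k2 hp hm hq0.
set b := H (Q *+ n.+1) in l1 l2 hp hm b0; set d := H (Q *+ n.+2) in hp hm d0 *.
rewrite -/h in k1 k2 l1 l2 hp hm.
have e : (h ^+ (n.+1 ^ 2) * h) ^+ 2 = h ^+ (n ^ 2) * h ^+ (n.+2 ^ 2).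
  rewrite -exprSr -exprM -exprD; congr (_ ^+ _).
  by rewrite !expnS !expn0; ring.
split.
  rewrite -(ler_pM2l (hpow (n ^ 2)%N)) -e.
  apply: (@le_trans _ _ ((L * b * h) ^+ 2)).
    by apply: lerXn2r; rewrite ?nnegrE ?mulr_ge0 ?ltW0 // ler_pM2r.
  rewrite -mulrA exprMn.
  apply: (@le_trans _ _ (L ^+ 2 * (c * C * (d * a)))).
    by rewrite ler_pM2l ?exprn_gt0.
  have -> : L ^+ 2 * (c * C * (d * a)) = (L ^+ 2 * (c * C) * d) * a by ring.
  have -> : h ^+ (n ^ 2) * (c * C * K * L ^+ 2 * d) =
    (L ^+ 2 * (c * C) * d) * (K * h ^+ (n ^ 2)) by ring.
  by rewrite ler_pM2l // !mulr_gt0 ?exprn_gt0.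
rewrite -(ler_pM2l (hpow (n ^ 2)%N)).
apply: (@le_trans _ _ (K * a * d)); first by rewrite ler_pM2r.
apply: (@le_trans _ _ (K * (C * (b * h) ^+ 2))).
  by rewrite -mulrA ler_pM2l // [a * d]mulrC.
have -> : h ^+ (n ^ 2) * (c * C * K * L ^+ 2 * h ^+ (n.+2 ^ 2)) =
  c * (K * (C * (L * h ^+ (n.+1 ^ 2) * h) ^+ 2)).
  have -> : (L * h ^+ (n.+1 ^ 2) * h) ^+ 2 =
    L ^+ 2 * (h ^+ (n ^ 2) * h ^+ (n.+2 ^ 2)) by rewrite -mulrA exprMn e.
  by move: (h ^+ _) (h ^+ _) => x y; ring.
apply: (@le_trans _ _ (K * (C * (L * h ^+ (n.+1 ^ 2) * h) ^+ 2))); last first.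
  by rewrite ler_peMl // !mulr_ge0 ?exprn_ge0 ?mulr_ge0 ?ltW0.
rewrite ler_pM2l // ler_pM2l //.
by apply: lerXn2r; rewrite ?nnegrE ?mulr_ge0 ?ltW0 // ler_pM2r.
Qed.

(** The cube is chosen so that the factor c is absorbed: g = H^3 / c satisfies
    g(2Q) >= g(Q)^4 exactly.  In the same way C' H^3 in
    [height_double_iter_le] is at most its fourth power under doubling. *)
Lemma height_double_iter_ge Q k :
  (H Q ^+ 3 / c) ^+ (4 ^ k) <= H (Q *+ 2 ^ k) ^+ 3 / c.
Proof.
have c0 : 0 < c by apply: lt_le_trans c1.
elim: k => [|k ih]; first by rewrite expn0 expr1.
rewrite !expnSr exprM mulrnA.
apply: (@le_trans _ _ ((H (Q *+ 2 ^ k) ^+ 3 / c) ^+ 4)).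
  by apply: lerXn2r => //; rewrite nnegrE ?exprn_ge0 // divr_ge0 ?exprn_ge0 ?ltW0.
have := Hdbl_ge (Q *+ 2 ^ k) => /(lerXn2r 3) h.
rewrite exprMn exprVn -exprM mulnC exprM.
have -> : H (Q *+ 2 ^ k *+ 2) ^+ 3 / c = (c * H (Q *+ 2 ^ k *+ 2)) ^+ 3 / c ^+ 4.
  by field; lra.
rewrite ler_pM2r ?invr_gt0 ?exprn_gt0 //; apply: h; rewrite nnegrE.
  by rewrite exprn_ge0 ?ltW0.
by rewrite mulr_ge0 ?ltW0.
Qed.

Lemma height_double_iter_le Q k :
  C' * H (Q *+ 2 ^ k) ^+ 3 <= (C' * H Q ^+ 3) ^+ (4 ^ k).
Proof.
elim: k => [|k ih]; first by rewrite expn0 expr1.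
rewrite !expnSr exprM mulrnA.
apply: (@le_trans _ _ ((C' * H (Q *+ 2 ^ k) ^+ 3) ^+ 4)); last first.
  by apply: lerXn2r => //; rewrite nnegrE ?exprn_ge0 // mulr_ge0 ?exprn_ge0 ?ltW0.
have := Hdbl_le (Q *+ 2 ^ k) => /(lerXn2r 3) h.
rewrite exprMn -exprM mulnC exprM [C' ^+ 4]exprS -mulrA ler_pM2l // -exprMn.
by apply: h; rewrite nnegrE ?mulr_ge0 ?exprn_ge0 ?ltW0.
Qed.

(** In terms of the canonical height this says that the height of 2 Q, which
    is 4 times that of Q, is at most the height of m Q.  Were it false, the
    iterates 2^k (2Q) would outgrow 2^(k+1) (mQ) = m 2^k (2Q)
    doubly exponentially, against [height_mulrn]. *)
Lemma height_of_multiple (Q : A) (m : int) : 2 <= `|m| ->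
  c < H (Q *+ 2) ^+ 3 -> H (Q *+ 2) ^+ 3 <= c * (C' * H (Q *~ m) ^+ 3).
Proof.
have c0 : 0 < c by apply: lt_le_trans c1.
move=> hm; set P := Q *~ m; set S := Q *+ 2 => hS.
pose n := `|m|%N; have n2 : (2 <= n)%N by rewrite /n; lia.
have HP k : H (P *+ k) = H (Q *+ n *+ k).
  rewrite /P /n; case: (m) => i; first by [].
  by rewrite NegzE mulrNz mulNrn HN.
set g := H S ^+ 3 / c; set u := C' * H P ^+ 3.
have g1 : 1 < g by rewrite /g ltr_pdivlMr // mul1r.
suff : g <= u by rewrite /g ler_pdivrMr // mulrC.
rewrite leNgt; apply/negP => ug.
have u0 : 0 < u by rewrite mulr_gt0 ?exprn_gt0.
have [K K0 hK] := height_mulrn n.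
have [e he] := @expr_unbounded _ (g / u) (K ^+ 3 / C')
  ltac:(by rewrite ltr_pdivlMr // mul1r).
have key : g ^+ (4 ^ e.+1) <= K ^+ 3 / C' * u ^+ (4 ^ e.+1).
  have hs : S *+ 2 ^ e *+ n = Q *+ n *+ 2 ^ e.+1.
    by rewrite /S -!mulrnA expnS; congr (_ *+ _); ring.
  have [h1 _] := hK (S *+ 2 ^ e); rewrite hs -HP in h1.
  have h2 := height_double_iter_ge S e; have h3 := height_double_iter_le P e.+1.
  have gn0 k : 0 <= g ^+ k by rewrite exprn_ge0 // ltW // (lt_trans _ g1).
  apply: (@le_trans _ _ (g ^+ (4 ^ e * n ^ 2))).
    rewrite ler_eXn2l // expnSr leq_pmul2l ?expn_gt0 //.
    by rewrite (@leq_exp2r 2 n 2).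
  rewrite exprM; apply: (@le_trans _ _ ((H (S *+ 2 ^ e) ^+ 3) ^+ (n ^ 2))).
    apply: lerXn2r; rewrite ?nnegrE ?exprn_ge0 ?ltW0 //.
      by apply: lt_trans g1.
    apply: le_trans h2 _; rewrite ler_pdivrMr // ler_peMr //.
    by rewrite exprn_ge0 // ltW0.
  rewrite -exprM mulnC exprM.
  apply: (@le_trans _ _ ((K * H (P *+ 2 ^ e.+1)) ^+ 3)).
    by apply: lerXn2r; rewrite ?nnegrE ?exprn_ge0 ?mulr_ge0 ?ltW0.
  rewrite exprMn -mulrA ler_pM2l ?exprn_gt0 //.
  by rewrite ler_pdivlMl.
have : (g / u) ^+ (4 ^ e.+1) <= K ^+ 3 / C'.
  by rewrite exprMn exprVn ler_pdivrMr ?exprn_gt0.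
apply/negP; rewrite -ltNge; apply: lt_le_trans he _.
rewrite ler_eXn2l; last by rewrite ltr_pdivlMr // mul1r.
by apply: leq_trans (ltnW (ltn_expl e.+1 (isT : 1 < 4)%N)).
Qed.

End HeightGrowth.

(** * The duplication forms *)

Section Forms.
Variable R : comNzRingType.
Implicit Types p q : R.

(** Homogeneous forms, with x = p / q: [cubic] is f, [cubic'] its derivative,
    and x(2Q) = dbl_num / dbl_den on the curve D y^2 = f(x). *)
Definition cubic p q := p ^+ 3 + 2 * p ^+ 2 * q + 163 * p * q ^+ 2 + 2205 * q ^+ 3.
Definition cubic' p q := 3 * p ^+ 2 + 4 * p * q + 163 * q ^+ 2.
Definition dbl_num p q :=
  p ^+ 4 - 2 * 163 * p ^+ 2 * q ^+ 2 - 8 * 2205 * p * q ^+ 3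
  + (163 ^+ 2 - 8 * 2205) * q ^+ 4.
Definition dbl_den p q := 4 * q * cubic p q.

(** The tangent at Q has slope f'(x) / (2 y). *)
Lemma dbl_numE p q : dbl_num p q = cubic' p q ^+ 2 - 8 * (p + q) * cubic p q.
Proof. by rewrite /dbl_num /cubic' /cubic; ring. Qed.

(** The resultant identity bounding the cancellation in x(2Q); the constant is
    minus four times the discriminant of f. *)
Lemma dbl_bezout p q :
  (12 * p ^+ 2 + 16 * p * q + 2592 * q ^+ 2) * q * dbl_num p q +
  (- 3 * p ^+ 3 + 2 * p ^+ 2 * q + 815 * p * q ^+ 2 + 11 * 5353 * q ^+ 3) * dbl_den p q
  = 36 * 247 ^+ 3 * q ^+ 7.
Proof. by rewrite /dbl_num /dbl_den /cubic; ring. Qed.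

(** The remainder of f modulo f': where both vanish modulo a prime, so does
    970 x + 19519, which locates the double root. *)
Lemma cubic_mod_deriv p q :
  9 * cubic p q = cubic' p q * (3 * p + 2 * q) + (970 * p + 131 * 149 * q) * q ^+ 2.
Proof. by rewrite /cubic' /cubic; ring. Qed.

End Forms.

Section RealBounds.
Variable R : realFieldType.
Implicit Types p q : R.

(** Numerator and denominator of x(2Q) are not small together.  For x of
    moderate size use dbl_num = f'^2 - 8 (x + 1) f, where f' is bounded below;
    for |x| > 40 the leading term of dbl_num dominates. *)
Lemma dbl_ge p q : 0 < q ->
  Num.max `|p| (10 * q) ^+ 4 <=
  4 * Num.max `|dbl_num p q| (10 * `|dbl_den p q|).
Proof.
move=> q0; set M := Num.max _ _; set N := Num.max _ _.
have hN1 : `|dbl_num p q| <= N by rewrite le_max lexx.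
have hN2 : 10 * `|dbl_den p q| <= N by rewrite le_max lexx orbT.
have [hp|hp] := leP `|p| (40 * q); last first.
  have -> : M = `|p| by apply/max_idPl; lra.
  (* Here dbl_num already exceeds half of p^4. *)
  suff : `|p| ^+ 4 <= 4 * `|dbl_num p q| by lra.
  have hF : `|p| ^+ 4 - 326 * `|p| ^+ 2 * q ^+ 2 - 8 * 2205 * `|p| * q ^+ 3
      <= `|dbl_num p q|.
    apply: le_trans (ler_norm _); rewrite /dbl_num.
    have -> : `|p| ^+ 4 = p ^+ 4 by rewrite -normrX ger0_norm // (@exprn_even_ge0 _ 4).
    have -> : `|p| ^+ 2 = p ^+ 2 by rewrite -normrX ger0_norm // sqr_ge0.
    have : p * q ^+ 3 <= `|p| * q ^+ 3 by rewrite ler_pM2r ?ler_norm ?exprn_gt0.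
    have : 0 < q ^+ 4 by rewrite exprn_gt0.
    nra.
  set a := `|p| in hF hp *.
  have h2 : 1600 * q ^+ 2 <= a ^+ 2 by nra.
  have h3 : 40 * q ^+ 3 <= a * q ^+ 2 by have := sqr_ge0 q; nra.
  have h4 : (64 * 1000) * (a * q ^+ 3) <= a ^+ 4.
    have -> : a ^+ 4 = a ^+ 2 * a ^+ 2 by ring.
    have : 40 * (a * q ^+ 3) <= a ^+ 2 * q ^+ 2.
      have -> : 40 * (a * q ^+ 3) = a * (40 * q ^+ 3) by ring.
      have -> : a ^+ 2 * q ^+ 2 = a * (a * q ^+ 2) by ring.
      by rewrite ler_wpM2l // normr_ge0.
    have : 1600 * (a ^+ 2 * q ^+ 2) <= a ^+ 2 * a ^+ 2.
      have -> : 1600 * (a ^+ 2 * q ^+ 2) = a ^+ 2 * (1600 * q ^+ 2) by ring.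
      by rewrite ler_wpM2l // sqr_ge0.
    lra.
  have h5 : 1600 * (a ^+ 2 * q ^+ 2) <= a ^+ 4.
    have -> : 1600 * (a ^+ 2 * q ^+ 2) = a ^+ 2 * (1600 * q ^+ 2) by ring.
    have -> : a ^+ 4 = a ^+ 2 * a ^+ 2 by ring.
    by rewrite ler_wpM2l // sqr_ge0.
  have : 0 <= a ^+ 4 by rewrite exprn_ge0 ?normr_ge0.
  lra.
have hd : cubic' p q ^+ 2 <= 46 / 5 * N.
  have -> : cubic' p q ^+ 2 = dbl_num p q + 8 * (p + q) * cubic p q.
    by rewrite dbl_numE; ring.
  have h1 : 8 * (p + q) * cubic p q <= 8 * (41 * q) * `|cubic p q|.
    apply: le_trans (ler_norm _) _; rewrite normrM normrM ger0_norm //.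
    rewrite ler_wpM2r // ler_pM2l //.
    by apply: le_trans (ler_normD _ _) _; rewrite [`|q|]gtr0_norm //; lra.
  have e : `|dbl_den p q| = 4 * q * `|cubic p q|.
    by rewrite /dbl_den normrM [`|4 * q|]gtr0_norm // mulr_gt0.
  by have := ler_norm (dbl_num p q); rewrite e in hN2; lra.
have hM : 38 * M ^+ 2 <= 25 * cubic' p q.
  have -> : M ^+ 2 = Num.max (p ^+ 2) (100 * q ^+ 2).
    have [h|h] := leP (10 * q) `|p|.
      rewrite /M (max_idPl h) -normrX ger0_norm ?sqr_ge0 //.
      apply/esym/max_idPl.
      have -> : p ^+ 2 = `|p| ^+ 2 by rewrite -normrX ger0_norm ?sqr_ge0.
      nra.
    rewrite /M (max_idPr (ltW h)); have -> : (10 * q) ^+ 2 = 100 * q ^+ 2 by ring.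
    apply/esym/max_idPr.
    have -> : p ^+ 2 = `|p| ^+ 2 by rewrite -normrX ger0_norm ?sqr_ge0.
    have := normr_ge0 p; nra.
  rewrite /cubic' maxr_pMr // ge_max; apply/andP; split.
    have := sqr_ge0 (37 * p + 50 * q); have := sqr_ge0 q; nra.
  have := sqr_ge0 (75 * p + 50 * q); have := sqr_ge0 q; nra.
have M0 : 0 <= M ^+ 2 by rewrite sqr_ge0.
have -> : M ^+ 4 = (M ^+ 2) ^+ 2 by rewrite -exprM.
nra.
Qed.

(** Termwise, with |q| at most a tenth of the maximum. *)
Lemma dbl_le p q : 0 < q ->
  Num.max `|dbl_num p q| (10 * `|dbl_den p q|) <=
  23 * Num.max `|p| (10 * q) ^+ 4.
Proof.
move=> q0; set M := Num.max _ (10 * q).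
have hp : `|p| <= M by rewrite le_max lexx.
have hq : `|q| <= M / 10.
  by rewrite gtr0_norm // ler_pdivlMr // mulrC le_max lexx orbT.
have M0 : 0 <= M by apply: le_trans hp.
have mono (c : R) (i j : nat) : 0 <= c ->
    `|c * p ^+ i * q ^+ j| <= c * (M ^+ i * (M / 10) ^+ j).
  move=> c0; rewrite !normrM !normrX ger0_norm // -mulrA ler_wpM2l //.
  rewrite ler_pM ?exprn_ge0 //.
    by apply: lerXn2r; rewrite ?nnegrE.
  by apply: lerXn2r; rewrite ?nnegrE //; lra.
have M4 : 0 <= M ^+ 4 by rewrite exprn_ge0.
rewrite ge_max; apply/andP; split.
  have h0 := mono 1 4%N 0%N ler01; have h1 := mono (2 * 163) 2%N 2%N ltac:(lra).
  have h2 := mono (8 * 2205) 1%N 3%N ltac:(lra).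
  have h3 := mono (163 ^+ 2 - 8 * 2205) 0%N 4%N ltac:(lra).
  have -> : dbl_num p q = 1 * p ^+ 4 * q ^+ 0 - (2 * 163) * p ^+ 2 * q ^+ 2 -
    (8 * 2205) * p ^+ 1 * q ^+ 3 + (163 ^+ 2 - 8 * 2205) * p ^+ 0 * q ^+ 4.
    by rewrite /dbl_num; ring.
  have E : 23 * M ^+ 4 = 1 * (M ^+ 4 * (M / 10) ^+ 0) +
    2 * 163 * (M ^+ 2 * (M / 10) ^+ 2) + 8 * 2205 * (M ^+ 1 * (M / 10) ^+ 3) +
    (163 ^+ 2 - 8 * 2205) * (M ^+ 0 * (M / 10) ^+ 4) +
    2071 / (100 * 100) * M ^+ 4 by field.
  rewrite E.
  apply: le_trans (ler_normD _ _) _; apply: le_trans (lerD (ler_normB _ _) (lexx _)) _.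
  apply: le_trans (lerD (lerD (ler_normB _ _) (lexx _)) (lexx _)) _.
  lra.
have h0 := mono 40 3%N 1%N ltac:(lra); have h1 := mono 80 2%N 2%N ltac:(lra).
have h2 := mono (40 * 163) 1%N 3%N ltac:(lra).
have h3 := mono (40 * 2205) 0%N 4%N ltac:(lra).
have -> : 10 * `|dbl_den p q| = `|40 * p ^+ 3 * q ^+ 1 + 80 * p ^+ 2 * q ^+ 2 +
    (40 * 163) * p ^+ 1 * q ^+ 3 + (40 * 2205) * p ^+ 0 * q ^+ 4|.
  rewrite -[X in X * _](@ger0_norm _ 10) // -normrM; congr `|_|.
  by rewrite /dbl_den /cubic; ring.
have E : 23 * M ^+ 4 = 40 * (M ^+ 3 * (M / 10) ^+ 1) +
    80 * (M ^+ 2 * (M / 10) ^+ 2) + (40 * 163) * (M ^+ 1 * (M / 10) ^+ 3) +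
    (40 * 2205) * (M ^+ 0 * (M / 10) ^+ 4) + 286 / 100 * M ^+ 4 by field.
rewrite E.
apply: le_trans (ler_normD _ _) _; apply: le_trans (lerD (ler_normD _ _) (lexx _)) _.
apply: le_trans (lerD (lerD (ler_normD _ _) (lexx _)) (lexx _)) _.
lra.
Qed.

End RealBounds.

(** * Cancellation in the duplication formula *)

Section Arithmetic.
Implicit Types p q k l w D : int.

Lemma dvdz_lin (k a b x y : int) : (k %| x)%Z -> (k %| y)%Z -> (k %| a * x + b * y)%Z.
Proof. by move=> hx hy; rewrite rpredD // dvdz_mull. Qed.

Lemma dvdz_le_norm k w : 0 < w -> (k %| w)%Z -> `|k| <= w.
Proof.
move=> w0; rewrite dvdzE => /dvdn_leq; rewrite absz_gt0 gt_eqF // => /(_ isT).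
by lia.
Qed.

(** f is irreducible modulo 2, so its form is odd at coprime arguments. *)
Lemma cubic_neq0 p q : coprimez p q -> cubic p q != 0.
Proof.
move=> cpq; apply/eqP => h.
have [a [r [ep hr]]] : exists a r : int, p = 2 * a + r /\ (r = 0 \/ r = 1).
  by exists (p %/ 2)%Z, (p %% 2)%Z; lia.
have [b [s [eq hs]]] : exists b s : int, q = 2 * b + s /\ (s = 0 \/ s = 1).
  by exists (q %/ 2)%Z, (q %% 2)%Z; lia.
have odd_rs : (2 %| r ^+ 3 + r * s ^+ 2 + s ^+ 3)%Z.
  have /= := congr1 (fun z => (z %% 2)%Z) h.
  have -> : cubic p q = (4 * a ^+ 3 + 6 * a ^+ 2 * r + 3 * a * r ^+ 2
      + p ^+ 2 * q + 81 * p * q ^+ 2 + a * q ^+ 2 + r * (2 * b ^+ 2 + 2 * b * s)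
      + 1102 * q ^+ 3 + 4 * b ^+ 3 + 6 * b ^+ 2 * s + 3 * b * s ^+ 2) * 2
      + (r ^+ 3 + r * s ^+ 2 + s ^+ 3) by rewrite /cubic ep eq; ring.
  by rewrite modzMDl mod0z => /dvdz_mod0P.
have [r0 s0] : r = 0 /\ s = 0 by move: odd_rs; case: hr hs => -> [] ->.
have : (2 %| gcdz p q)%Z.
  by rewrite dvdz_gcd ep eq r0 s0 !addr0 !dvdz_mulr.
by rewrite (eqP cpq).
Qed.

(** dbl_num is p^4 modulo q. *)
Lemma coprime_dbl_num p q : coprimez p q -> coprimez (dbl_num p q) q.
Proof.
move=> cpq; have -> : dbl_num p q = (- 2 * 163 * p ^+ 2 * q -
    8 * 2205 * p * q ^+ 2 + (163 ^+ 2 - 8 * 2205) * q ^+ 3) * q + p ^+ 4.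
  by rewrite /dbl_num; ring.
rewrite coprimez_sym /coprimez gcdzMDl.
by rewrite -/(coprimez _ _) coprimez_sym coprimezXl.
Qed.

Lemma dvd_dbl p q k : coprimez p q ->
  (k %| dbl_num p q)%Z -> (k %| dbl_den p q)%Z -> (k %| 36 * 247 ^+ 3)%Z.
Proof.
move=> cpq kn kd.
have ckq : coprimez k (q ^+ 7).
  by apply/coprimezXr/(coprimez_dvdl kn)/coprime_dbl_num.
by rewrite -(Gauss_dvdzl _ ckq) -(dbl_bezout p q) dvdz_lin.
Qed.

(** Cancellation at l forces l to divide both f and f', so x reduces to the
    double root r of f modulo l.  When f(r) is divisible by l^2 and f'(r) by l,
    the Taylor expansion at r gives one more factor l. *)
Lemma dvd_cubic_node p q l r : prime `|l| -> coprimez l 4 -> coprimez l 970 ->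
  (l %| 970 * r + 131 * 149)%Z -> (l ^+ 2 %| cubic r 1)%Z -> (l %| cubic' r 1)%Z ->
  coprimez p q -> (l %| dbl_num p q)%Z -> (l %| dbl_den p q)%Z ->
  (l ^+ 2 %| cubic p q)%Z.
Proof.
move=> pl l4 l970 hr hr2 hr1 cpq ln ld.
have clq : coprimez l q by apply: coprimez_dvdl ln (coprime_dbl_num cpq).
have lc : (l %| cubic p q)%Z.
  by move: ld; rewrite Gauss_dvdzr // coprimezMr l4.
have lc' : (l %| cubic' p q)%Z.
  have : (l %| cubic' p q ^+ 2)%Z.
    have -> : cubic' p q ^+ 2 = 1 * dbl_num p q + 8 * (p + q) * cubic p q.
      by rewrite dbl_numE; ring.
    exact: (dvdz_lin 1 _ ln lc).
  by rewrite !dvdzE abszX Euclid_dvdX //= andbT.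
have lz : (l %| p - r * q)%Z.
  rewrite -(Gauss_dvdzr _ l970).
  have -> : 970 * (p - r * q) =
     1 * (970 * p + 131 * 149 * q) + (- q) * (970 * r + 131 * 149) by ring.
  apply: dvdz_lin => //; rewrite -(Gauss_dvdzl _ (coprimezXr 2 clq)).
  have -> : (970 * p + 131 * 149 * q) * q ^+ 2 =
      9 * cubic p q + (- (3 * p + 2 * q)) * cubic' p q.
    by rewrite cubic_mod_deriv; ring.
  exact: dvdz_lin.
have -> : cubic p q = cubic r 1 * q ^+ 3 + (cubic' r 1 * (p - r * q)) * q ^+ 2 +
    (3 * r + 2) * q * (p - r * q) ^+ 2 + (p - r * q) * (p - r * q) ^+ 2.
  by rewrite /cubic /cubic'; ring.
have lz2 : (l ^+ 2 %| (p - r * q) ^+ 2)%Z by apply: dvdz_exp2r.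
rewrite !rpredD ?(dvdz_mull _ lz2) //; first exact: dvdz_mulr.
by apply: dvdz_mulr; rewrite expr2 dvdz_mul.
Qed.

Lemma squarefree_prime_dvd D w l n : squarefree D -> prime `|l| ->
  D * w ^+ 2 = n -> (l ^+ 2 %| n)%Z -> (l %| w)%Z.
Proof.
move=> sD pl <- h; apply: contraT => nlw.
have cl : coprimez (l ^+ 2) (w ^+ 2).
  apply/coprimezXr/coprimezXl; rewrite coprimezE prime_coprime //.
have := sD l; rewrite -(Gauss_dvdzl D cl) h => /(_ isT) e.
by move: pl; have -> : `|l|%N = 1%N by lia.
Qed.

(** Trades a factor l^3 for l u^2 with u = 1 or l, according to whether l
    divides k. *)
Lemma dvd_prime_cube_square n k w l : prime `|l| ->
  (k %| n * l ^+ 3)%Z -> ((l %| k)%Z -> (l %| w)%Z) ->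
  exists u, [/\ (u %| l)%Z, (u %| w)%Z & (k %| n * l * u ^+ 2)%Z].
Proof.
move=> pl kn lw; have [lk|lk] := boolP (l %| k)%Z.
  by exists l; split=> //; [exact: lw|rewrite -mulrA -exprS].
exists 1; split; rewrite ?dvd1z // expr1n mulr1 dvdz_mulr //.
move: kn; rewrite Gauss_dvdzl //.
by rewrite coprimez_sym; apply: coprimezXl; rewrite coprimezE prime_coprime.
Qed.

(** The nodes modulo 13 and 19 are at 9 and 13.  There a cancellation of up to
    l^3 costs only l, because w^2 contributes l^2. *)
Lemma dvd_dbl_square D p q k w : squarefree D -> coprimez p q -> w != 0 ->
  D * w ^+ 2 = q * cubic p q ->
  (k %| dbl_num p q)%Z -> (k %| dbl_den p q)%Z -> `|k| <= 36 * 247 * w ^+ 2.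
Proof.
move=> sD cpq w0 eD kn kd.
have h13 : (13 %| k)%Z -> (13 %| w)%Z.
  move=> h; apply: squarefree_prime_dvd sD _ eD _ => //; apply: dvdz_mull.
  by apply: (@dvd_cubic_node _ _ _ 9) => //; apply: dvdz_trans h _.
have h19 : (19 %| k)%Z -> (19 %| w)%Z.
  move=> h; apply: squarefree_prime_dvd sD _ eD _ => //; apply: dvdz_mull.
  by apply: (@dvd_cubic_node _ _ _ 13) => //; apply: dvdz_trans h _.
have := dvd_dbl cpq kn kd.
have -> : 36 * 247 ^+ 3 = 36 * 13 ^+ 3 * 19 ^+ 3 :> int by ring.
move=> /dvd_prime_cube_square /(_ h19) [] // u [u19 uw].
have -> : 36 * 13 ^+ 3 * 19 * u ^+ 2 = 36 * 19 * u ^+ 2 * 13 ^+ 3 by ring.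
move=> /dvd_prime_cube_square /(_ h13) [] // v [v13 vw].
have -> : 36 * 19 * u ^+ 2 * 13 * v ^+ 2 = 36 * 247 * (u * v) ^+ 2 by ring.
have uvw : (u * v %| w)%Z.
  rewrite Gauss_dvdz ?uw ?vw //.
  exact: coprimez_dvdl u19 (coprimez_dvdr v13 _).
move=> kuv; have h : (k %| 36 * 247 * w ^+ 2)%Z.
  by apply: dvdz_trans kuv _; rewrite dvdz_mul // dvdz_exp2r.
by apply: dvdz_le_norm h; rewrite mulr_gt0 // exprn_even_gt0.
Qed.

End Arithmetic.

(** * Heights of rational numbers *)

Lemma squarefree_mul_sqr_int (D N : int) (y : rat) : squarefree D ->
  D%:~R * y ^+ 2 = N%:~R -> exists w : int, y = w%:~R.
Proof.
move=> sD e; exists (numq y); rewrite -[LHS]divq_num_den.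
suff -> : denq y = 1 by rewrite divr1.
have : (denq y ^+ 2 %| D * numq y ^+ 2)%Z.
  apply/dvdzP; exists N; apply/eqP; rewrite -(eqr_int rat).
  apply/eqP; transitivity (D%:~R * (numq y)%:~R ^+ 2 : rat); first by ring.
  rewrite numqE; transitivity (D%:~R * y ^+ 2 * (denq y)%:~R ^+ 2); first by ring.
  by rewrite e; ring.
have c : coprimez (denq y ^+ 2) (numq y ^+ 2).
  by apply/coprimezXl/coprimezXr; rewrite coprimez_sym coprimezE coprime_num_den.
by rewrite Gauss_dvdzl // => /sD; rewrite gtr0_norm.
Qed.

Section RationalHeight.
Variable R : realFieldType.
Implicit Types x : rat.

(** The weight 10 balances the real place: the real root of f lies between
    -10 and -9, and on the scale |x| = 10 the loss in [dbl_ge] and [dbl_le] is small.  It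
    also gains a factor 10 when only the denominator is known. *)
Definition rat_height x : R := Num.max `|(numq x)%:~R| (10 * (denq x)%:~R).

Lemma rat_height_ge x : 10 <= rat_height x.
Proof.
rewrite le_max; apply/orP; right.
rewrite -[leLHS]mulr1 ler_pM2l // ler1z; have := denq_gt0 x; lia.
Qed.

Lemma rat_height_ge1 x : 1 <= rat_height x.
Proof. by apply: le_trans (rat_height_ge x); rewrite ler1n. Qed.

Lemma rat_frac x (a b : int) : b != 0 -> x = a%:~R / b%:~R ->
  exists k, [/\ k != 0, a = k * numq x & b = k * denq x].
Proof.
move=> b0 e.
have b0' : b%:~R != 0 :> rat by rewrite intr_eq0.
have eab : a * denq x = numq x * b.
  apply/eqP; rewrite -(eqr_int rat) !rmorphM /= numqE {2}e.
  by apply/eqP; field.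
have : (denq x %| b)%Z.
  rewrite -(@Gauss_dvdzr _ (numq x)); last first.
    by rewrite coprimez_sym coprimezE coprime_num_den.
  by rewrite -eab dvdz_mull.
case/dvdzP => k eb; exists k; split=> //.
  by apply: contraNneq b0 => k0; rewrite eb k0 mul0r.
apply: (mulIf (denq_neq0 x)); rewrite eab eb; ring.
Qed.

Lemma rat_height_frac x (a b k : int) : a = k * numq x -> b = k * denq x ->
  Num.max `|a%:~R| (10 * `|b%:~R|) = `|k%:~R| * rat_height x.
Proof.
move=> -> ->; rewrite /rat_height maxr_pMr // !rmorphM /= !normrM; congr Num.max.
by rewrite [`|(denq x)%:~R|]gtr0_norm ?ltr0z ?denq_gt0 //; ring.
Qed.

Lemma norm_int_ge1 (k : int) : k != 0 -> 1 <= `|k%:~R| :> R.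
Proof. by move=> k0; rewrite -intr_norm ler1z; lia. Qed.

Lemma dbl_frac x : cubic x 1 != 0 -> let p := numq x in let q := denq x in
  exists k, [/\ k != 0, dbl_num p q = k * numq (dbl_num x 1 / dbl_den x 1) &
                dbl_den p q = k * denq (dbl_num x 1 / dbl_den x 1)].
Proof.
move=> c0 p q; have q0 := denq_gt0 x.
have q0' : (denq x)%:~R != 0 :> rat by rewrite intr_eq0 denq_neq0.
have cpq : coprimez p q by rewrite coprimezE coprime_num_den.
have en : (dbl_num p q)%:~R = dbl_num x 1 * q%:~R ^+ 4.
  rewrite -[in RHS](divq_num_den x) -/p -/q /dbl_num; field.
  by rewrite -/q in q0'.
have ed : (dbl_den p q)%:~R = dbl_den x 1 * q%:~R ^+ 4.
  rewrite -[in RHS](divq_num_den x) -/p -/q /dbl_den /cubic; field.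
  by rewrite -/q in q0'.
apply: rat_frac.
  by apply: mulf_neq0 (cubic_neq0 cpq); rewrite mulf_neq0 ?denq_neq0.
rewrite en ed; field.
rewrite q0' /=; apply: mulf_neq0 c0; by rewrite mulf_neq0 ?oner_eq0 ?pnatr_eq0.
Qed.

Lemma rat_height_dbl_ge x : cubic x 1 != 0 ->
  rat_height x ^+ 4 <= 144 * 247 ^+ 3 * rat_height (dbl_num x 1 / dbl_den x 1).
Proof.
move=> c0; have [k [k0 en ed]] := dbl_frac c0.
have cpq : coprimez (numq x) (denq x) by rewrite coprimezE coprime_num_den.
have := @dbl_ge R (numq x)%:~R (denq x)%:~R; rewrite ltr0z denq_gt0 => /(_ isT).
have -> : dbl_num (numq x)%:~R (denq x)%:~R = (dbl_num (numq x) (denq x))%:~R :> R.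
  by rewrite /dbl_num; ring.
have -> : dbl_den (numq x)%:~R (denq x)%:~R = (dbl_den (numq x) (denq x))%:~R :> R.
  by rewrite /dbl_den /cubic; ring.
rewrite (rat_height_frac en ed).
rewrite -[X in Num.max X _]/`|(numq x)%:~R| -/(rat_height x).
set h2 := rat_height (_ / _) => h; apply: (le_trans h).
have h20 : 0 < h2 by apply: lt_le_trans (rat_height_ge _).
rewrite mulrA ler_pM2r //.
have : (k %| 36 * 247 ^+ 3)%Z.
  by apply: (dvd_dbl cpq); rewrite ?en ?ed dvdz_mulr.
move=> /dvdz_le_norm; rewrite mulr_gt0 ?exprn_gt0 // => /(_ isT).
rewrite -(ler_int R) intr_norm; lra.
Qed.

Lemma rat_height_dbl_le x : cubic x 1 != 0 ->
  rat_height (dbl_num x 1 / dbl_den x 1) <= 23 * rat_height x ^+ 4.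
Proof.
move=> c0; have [k [k0 en ed]] := dbl_frac c0.
have := @dbl_le R (numq x)%:~R (denq x)%:~R; rewrite ltr0z denq_gt0 => /(_ isT).
have -> : dbl_num (numq x)%:~R (denq x)%:~R = (dbl_num (numq x) (denq x))%:~R :> R.
  by rewrite /dbl_num; ring.
have -> : dbl_den (numq x)%:~R (denq x)%:~R = (dbl_den (numq x) (denq x))%:~R :> R.
  by rewrite /dbl_den /cubic; ring.
rewrite (rat_height_frac en ed) -/(rat_height x); apply: le_trans.
rewrite ler_peMl ?norm_int_ge1 //; apply: le_trans (rat_height_ge _); lra.
Qed.

(** The square-free D survives in the denominator of x(2Q); the factor 2223 is
    36 * 247 / 4. *)
Lemma rat_height_dbl_twist x y (D : int) : squarefree D ->
  D%:~R * y ^+ 2 = cubic x 1 ->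
  10 * D%:~R <= 2223 * rat_height (dbl_num x 1 / dbl_den x 1).
Proof.
move=> sD e.
set p := numq x; set q := denq x; have q0 : 0 < q := denq_gt0 x.
have q0' : q%:~R != 0 :> rat by rewrite intr_eq0 denq_neq0.
have cpq : coprimez p q by rewrite coprimezE coprime_num_den.
have ec : (q * cubic p q)%:~R = D%:~R * (y * q%:~R ^+ 2) ^+ 2.
  have -> : D%:~R * (y * q%:~R ^+ 2) ^+ 2 = cubic x 1 * q%:~R ^+ 4.
    by rewrite -e; ring.
  rewrite -[in RHS](divq_num_den x) -/p -/q /cubic; field.
  exact: q0'.
have [w ew] := squarefree_mul_sqr_int sD (esym ec).
have eD : D * w ^+ 2 = q * cubic p q.
  by apply/eqP; rewrite -(eqr_int rat) ec ew; apply/eqP; ring.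
have qc0 : q * cubic p q != 0 by rewrite mulf_neq0 ?cubic_neq0 ?denq_neq0.
have w0 : w != 0 by apply: contraNneq qc0 => w0; rewrite -eD w0 expr0n mulr0.
have c0 : cubic x 1 != 0.
  rewrite -e; apply: contraNneq qc0 => h; rewrite -(eqr_int rat) ec.
  by apply/eqP; rewrite exprMn mulrA h mul0r.
have [k [k0 en ed]] := dbl_frac c0; rewrite -/p -/q in en ed.
have hk : `|k| <= 36 * 247 * w ^+ 2.
  by apply: (dvd_dbl_square sD cpq w0 eD); rewrite ?en ?ed dvdz_mulr.
set x2 := dbl_num x 1 / _ in en ed *.
have d0 : 0 < denq x2 := denq_gt0 x2.
have hD : D <= 2223 * denq x2.
  have w2 : 0 < 4 * w ^+ 2 by rewrite mulr_gt0 // exprn_even_gt0.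
  rewrite -(ler_pM2l w2).
  have -> : 4 * w ^+ 2 * D = k * denq x2.
    by rewrite -ed /dbl_den -[RHS]mulrA -eD; ring.
  apply: (@le_trans _ _ (`|k| * denq x2)); first by rewrite ler_pM2r // ler_norm.
  have -> : 4 * w ^+ 2 * (2223 * denq x2) = 36 * 247 * w ^+ 2 * denq x2 by ring.
  by rewrite ler_pM2r.
have : D%:~R <= 2223 * (denq x2)%:~R :> R.
  by move: hD; rewrite -(ler_int R) rmorphM.
have : 10 * (denq x2)%:~R <= rat_height x2 by rewrite le_max lexx orbT.
lra.
Qed.

End RationalHeight.

(** * Heights and chords *)

(** The product of the primitive polynomials (b X + a) and (d X + c) is
    primitive, so the triple (G0, G1, G2) proportional to its coefficients is
    an integral multiple of it. *)
Lemma dvdz_primitive_scaling (a b c d G0 G1 G2 : int) :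
  coprimez a b -> coprimez c d ->
  G0 * (a * d + b * c) = G1 * (b * d) -> G0 * (a * c) = G2 * (b * d) ->
  (b * d %| G0)%Z.
Proof.
move=> /coprimezP[[u v] /= e1] /coprimezP[[w z] /= e2] h1 h2.
pose X := u * z * (a * d); pose Y := v * w * (b * c).
pose T := u * w * (a * c) + v * z * (b * d).
have e : T + (X + Y) = 1.
  have <- : (u * a + v * b) * (w * c + z * d) = 1 by rewrite e1 e2.
  by rewrite /T /X /Y; ring.
have hac : (b * d %| G0 * (a * c))%Z by rewrite h2 dvdz_mull.
have hS : (b * d %| G0 * (a * d + b * c))%Z by rewrite h1 dvdz_mull.
have hbd : (b * d %| G0 * (b * d))%Z by rewrite dvdz_mull.
have hT : (b * d %| G0 * T)%Z.
  have -> : G0 * T = (u * w) * (G0 * (a * c)) + (v * z) * (G0 * (b * d)).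
    by rewrite /T; ring.
  exact: dvdz_lin.
have hX : (b * d %| G0 * X ^+ 2)%Z.
  have -> : G0 * X ^+ 2 = (u * z) ^+ 2 * (a * d) * (G0 * (a * d + b * c)) +
      (- ((u * z) ^+ 2 * (a * c))) * (G0 * (b * d)) by rewrite /X; ring.
  exact: dvdz_lin.
have hY : (b * d %| G0 * Y ^+ 2)%Z.
  have -> : G0 * Y ^+ 2 = (v * w) ^+ 2 * (b * c) * (G0 * (a * d + b * c)) +
      (- ((v * w) ^+ 2 * (a * c))) * (G0 * (b * d)) by rewrite /Y; ring.
  exact: dvdz_lin.
(* Cube the relation T + X + Y = 1: the mixed terms in X and Y are multiples
   of X^2 or Y^2. *)
have -> : G0 = 1 * ((T ^+ 2 + 3 * T * (X + Y) + 3 * (X + Y) ^+ 2) * (G0 * T)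
  + (X + 3 * Y) * (G0 * X ^+ 2)) + (Y + 3 * X) * (G0 * Y ^+ 2).
  have -> : 1 * ((T ^+ 2 + 3 * T * (X + Y) + 3 * (X + Y) ^+ 2) * (G0 * T)
  + (X + 3 * Y) * (G0 * X ^+ 2)) + (Y + 3 * X) * (G0 * Y ^+ 2) =
   G0 * (T + (X + Y)) ^+ 3 by ring.
  by rewrite e expr1n mulr1.
by apply: dvdz_lin => //; apply: dvdz_lin.
Qed.

Section Heights.
Variable R : realFieldType.
Local Notation rat_height := (rat_height R).

Lemma norm_root_le (s m K : R) : 0 <= K -> `|s + m| <= K -> `|s * m| <= K ^+ 2 ->
  `|s| <= 2 * K.
Proof.
move=> K0 hs hm; have [h|h] := leP `|m| K.
  by have := ler_normB (s + m) m; rewrite addrK; lra.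
rewrite normrM in hm; have := normr_ge0 s; nra.
Qed.

(** Two rational roots of a quadratic with integer coefficients bounded by K:
    after clearing the common content, all products of a numerator or
    denominator of x3 with one of x4 are at most 2 K. *)
Lemma rat_height_mul_le (x3 x4 : rat) (G0 G1 G2 : int) (K : R) : G0 != 0 ->
  (x3 + x4) * G0%:~R = G1%:~R -> x3 * x4 * G0%:~R = G2%:~R ->
  `|G0%:~R| <= K -> `|G1%:~R| <= K -> `|G2%:~R| <= K ->
  rat_height x3 * rat_height x4 <= 100 * K.
Proof.
move=> G00 hs hm k0 k1 k2.
set a := numq x3; set b := denq x3; set c := numq x4; set d := denq x4.
have b0 : 0 < b := denq_gt0 x3; have d0 : 0 < d := denq_gt0 x4.
have e1 : G0 * (a * d + b * c) = G1 * (b * d).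
  apply/eqP; rewrite -(eqr_int rat); apply/eqP.
  transitivity (G0%:~R * (a%:~R * d%:~R + b%:~R * c%:~R) : rat); first by ring.
  transitivity (G1%:~R * (b%:~R * d%:~R) : rat); last by ring.
  by rewrite /a /c !numqE -/b -/d -hs; ring.
have e2 : G0 * (a * c) = G2 * (b * d).
  apply/eqP; rewrite -(eqr_int rat); apply/eqP.
  transitivity (G0%:~R * (a%:~R * c%:~R) : rat); first by ring.
  transitivity (G2%:~R * (b%:~R * d%:~R) : rat); last by ring.
  by rewrite /a /c !numqE -/b -/d -hm; ring.
have [j ej] : exists j, G0 = j * (b * d).
  by apply/dvdzP/(dvdz_primitive_scaling _ _ e1 e2); rewrite coprimezE coprime_num_den.
have j0 : j != 0 by apply: contraNneq G00 => j0; rewrite ej j0 mul0r.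
have bd0 : b * d != 0 by rewrite mulf_neq0 ?denq_neq0.
have f1 : G1 = j * (a * d + b * c).
  by apply: (mulIf bd0); rewrite -e1 ej; ring.
have f2 : G2 = j * (a * c) by apply: (mulIf bd0); rewrite -e2 ej; ring.
have scale (z : int) : `|(j * z)%:~R| <= K -> `|z%:~R| <= K.
  by apply: le_trans; rewrite rmorphM normrM ler_peMl // norm_int_ge1.
rewrite ej in k0; rewrite f1 in k1; rewrite f2 in k2.
move: k0 k1 k2 => /scale k0 /scale k1 /scale k2 {scale}.
have K0 : 0 <= K by apply: le_trans k2.
have B0 : 0 < b%:~R :> R by rewrite ltr0z.
have D0 : 0 < d%:~R :> R by rewrite ltr0z.
have m0 : b%:~R * d%:~R <= K by apply: le_trans (ler_norm _) _; rewrite -rmorphM.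
have m2 : `|a%:~R| * `|c%:~R| <= K by rewrite -normrM -rmorphM.
have hprod : `|(a * d)%:~R * (b * c)%:~R| <= K ^+ 2.
  have -> : (a * d)%:~R * (b * c)%:~R = (a * c)%:~R * (b * d)%:~R :> R by ring.
  by rewrite normrM expr2 ler_pM.
have m3 : `|a%:~R| * d%:~R <= 2 * K.
  have := @norm_root_le (a * d)%:~R (b * c)%:~R K K0; rewrite -rmorphD => /(_ k1 hprod).
  by rewrite rmorphM normrM [`|d%:~R|]gtr0_norm.
have m4 : b%:~R * `|c%:~R| <= 2 * K.
  have := @norm_root_le (b * c)%:~R (a * d)%:~R K K0.
  rewrite -rmorphD addrC [X in `|X| <= K ^+ 2]mulrC => /(_ k1 hprod).
  by rewrite rmorphM normrM [`|b%:~R|]gtr0_norm.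
rewrite /rat_height -/a -/b -/c -/d.
have [h3|h3] := leP `|a%:~R| (10 * b%:~R : R);
  have [h4|h4] := leP `|c%:~R| (10 * d%:~R : R); nra.
Qed.

(** The sum and the product of x(P + Q) and x(P - Q), multiplied by
    (x2 - x1)^2, as bihomogeneous forms in x1 = p1 / q1 and x2 = p2 / q2. *)
Definition chord_sum (S : comNzRingType) (p1 q1 p2 q2 : S) :=
  2 * ((p1 * p2 + 163 * q1 * q2) * (p1 * q2 + p2 * q1) +
    4 * p1 * p2 * q1 * q2 + 2 * 2205 * q1 ^+ 2 * q2 ^+ 2).
Definition chord_prod (S : comNzRingType) (p1 q1 p2 q2 : S) :=
  (p1 * p2 - 163 * q1 * q2) ^+ 2
    - 4 * 2205 * q1 * q2 * (p1 * q2 + p2 * q1 + 2 * q1 * q2).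

Lemma rat_height_chord (x1 x2 x3 x4 : rat) : x1 != x2 ->
  (x3 + x4) * (x2 - x1) ^+ 2 = chord_sum x1 1 x2 1 ->
  x3 * x4 * (x2 - x1) ^+ 2 = chord_prod x1 1 x2 1 ->
  rat_height x3 * rat_height x4 <= 6400 * 1000 * (rat_height x1 * rat_height x2) ^+ 2.
Proof.
move=> x12 hs hm.
set p1 := numq x1; set q1 := denq x1; set p2 := numq x2; set q2 := denq x2.
have q10 : q1%:~R != 0 :> rat by rewrite intr_eq0 denq_neq0.
have q20 : q2%:~R != 0 :> rat by rewrite intr_eq0 denq_neq0.
have ep1 : p1%:~R = x1 * q1%:~R := numqE x1.
have ep2 : p2%:~R = x2 * q2%:~R := numqE x2.
pose G0 := (p2 * q1 - p1 * q2) ^+ 2.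
have eG0 : G0%:~R = (x2 - x1) ^+ 2 * (q1%:~R * q2%:~R) ^+ 2 :> rat.
  transitivity ((p2%:~R * q1%:~R - p1%:~R * q2%:~R) ^+ 2 : rat).
    by rewrite /G0; ring.
  by rewrite ep1 ep2; ring.
have G00 : G0 != 0.
  rewrite -(intr_eq0 rat) eG0 mulf_neq0 ?expf_neq0 ?mulf_neq0 //.
  by rewrite subr_eq0 eq_sym.
have hs' : (x3 + x4) * G0%:~R = (chord_sum p1 q1 p2 q2)%:~R.
  rewrite eG0 mulrA hs.
  transitivity (chord_sum p1%:~R q1%:~R p2%:~R q2%:~R : rat).
    by rewrite /chord_sum ep1 ep2; ring.
  by rewrite /chord_sum; ring.
have hm' : x3 * x4 * G0%:~R = (chord_prod p1 q1 p2 q2)%:~R.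
  rewrite eG0 mulrA hm.
  transitivity (chord_prod p1%:~R q1%:~R p2%:~R q2%:~R : rat).
    by rewrite /chord_prod ep1 ep2; ring.
  by rewrite /chord_prod; ring.
set H1 := rat_height x1; set H2 := rat_height x2.
have H10 : 10 <= H1 := rat_height_ge R x1; have H20 : 10 <= H2 := rat_height_ge R x2.
have hp1 : `|p1%:~R| <= H1 by rewrite le_max lexx.
have hp2 : `|p2%:~R| <= H2 by rewrite le_max lexx.
have hq1 : `|q1%:~R| <= H1.
  have : 10 * q1%:~R <= H1 by rewrite le_max lexx orbT.
  rewrite gtr0_norm ?ltr0z ?denq_gt0 //.
  have : 0 < q1%:~R :> R by rewrite ltr0z denq_gt0.
  lra.
have hq2 : `|q2%:~R| <= H2.
  have : 10 * q2%:~R <= H2 by rewrite le_max lexx orbT.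
  rewrite gtr0_norm ?ltr0z ?denq_gt0 //.
  have : 0 < q2%:~R :> R by rewrite ltr0z denq_gt0.
  lra.
set B := H1 * H2.
have B0 : 0 <= B by rewrite mulr_ge0 //; lra.
have hB (u v : R) : `|u| <= H1 -> `|v| <= H2 -> `|u * v| <= B.
  by move=> hu hv; rewrite normrM ler_pM.
have hB2 (u v : R) : `|u| <= B -> `|v| <= B -> `|u * v| <= B ^+ 2.
  by move=> hu hv; rewrite normrM expr2 ler_pM.
set P := p1%:~R * p2%:~R : R; set Q := q1%:~R * q2%:~R : R.
set X := p1%:~R * q2%:~R : R; set Y := q1%:~R * p2%:~R : R.
have hP : `|P| <= B by apply: hB. have hQ : `|Q| <= B by apply: hB.
have hX : `|X| <= B by apply: hB. have hY : `|Y| <= B by apply: hB.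
have -> : 6400 * 1000 * B ^+ 2 = 100 * (64 * 1000 * B ^+ 2) by ring.
apply: (rat_height_mul_le G00 hs' hm').
- have -> : G0%:~R = Y * Y - X * Y - X * Y + X * X :> R.
    by rewrite /G0 /X /Y; ring.
  have := hB2 _ _ hX hX; have := hB2 _ _ hX hY; have := hB2 _ _ hY hY.
  by rewrite !ler_norml => /andP[? ?] /andP[? ?] /andP[? ?]; apply/andP; split; lra.
- have -> : (chord_sum p1 q1 p2 q2)%:~R =
      2 * (P * X + P * Y + 163 * (Q * X) + 163 * (Q * Y) + 4 * (P * Q) +
           2 * 2205 * (Q * Q)) :> R.
    by rewrite /chord_sum /P /Q /X /Y; ring.
  have := hB2 _ _ hP hX; have := hB2 _ _ hP hY; have := hB2 _ _ hQ hX.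
  have := hB2 _ _ hQ hY; have := hB2 _ _ hP hQ; have := hB2 _ _ hQ hQ.
  rewrite !ler_norml => /andP[? ?] /andP[? ?] /andP[? ?] /andP[? ?] /andP[? ?] /andP[? ?].
  by apply/andP; split; lra.
have -> : (chord_prod p1 q1 p2 q2)%:~R =
    P * P - 2 * 163 * (P * Q) + 163 ^+ 2 * (Q * Q)
     - 4 * 2205 * (Q * X + Q * Y + 2 * (Q * Q)) :> R.
  by rewrite /chord_prod /P /Q /X /Y; ring.
have := hB2 _ _ hP hP; have := hB2 _ _ hP hQ; have := hB2 _ _ hQ hX.
have := hB2 _ _ hQ hY; have := hB2 _ _ hQ hQ.
rewrite !ler_norml => /andP[? ?] /andP[? ?] /andP[? ?] /andP[? ?] /andP[? ?].
by apply/andP; split; lra.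
Qed.

End Heights.

(** * Points on the twisted curve *)

Lemma cubic_rat_neq0 (x : rat) : cubic x 1 != 0.
Proof.
have q0 : (denq x)%:~R != 0 :> rat by rewrite intr_eq0 denq_neq0.
have : (cubic (numq x) (denq x))%:~R != 0 :> rat.
  by rewrite intr_eq0 cubic_neq0 // coprimezE coprime_num_den.
have -> : (cubic (numq x) (denq x))%:~R = cubic x 1 * (denq x)%:~R ^+ 3.
  move: q0 (numqE x); move: (numq x) (denq x) => p q q0 /= ep.
  transitivity (cubic p%:~R q%:~R : rat); first by rewrite /cubic; ring.
  by rewrite ep /cubic; ring.
by rewrite mulf_eq0 negb_or => /andP[].
Qed.

(** The quadratic twist of y^2 = f(x) by D, over any field in which f has no
    root. *)
Section Twist.
Variables (F : fieldType) (E : ellcurve F) (D : F).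
Hypotheses (D0 : D != 0) (noroot : forall x : F, cubic x 1 != 0).
Hypotheses (a2E : a2 E = 2 * D) (a4E : a4 E = 163 * D ^+ 2).
Hypothesis a6E : a6 E = 2205 * D ^+ 3.
Implicit Types (P Q : point E) (x y : F).

Definition at_xy Q x y := coords Q = Some (D * x, D ^+ 2 * y).

Lemma at_xy_cubic Q x y : at_xy Q x y -> D * y ^+ 2 = cubic x 1.
Proof.
move=> e; have := valP Q; rewrite /= e /= a2E a4E a6E => /eqP h.
apply: (mulfI (expf_neq0 3 D0)); rewrite /cubic.
transitivity ((D ^+ 2 * y) ^+ 2); first by ring.
by rewrite h; ring.
Qed.

Lemma at_xy_y_neq0 Q x y : at_xy Q x y -> y != 0.
Proof.
move=> /at_xy_cubic e; apply: contraNneq (noroot x) => y0.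
by rewrite -e y0 expr0n mulr0.
Qed.

Lemma at_xy_coords Q X Y : coords Q = Some (X, Y) -> at_xy Q (X / D) (Y / D ^+ 2).
Proof.
by move=> e; rewrite /at_xy e [D * _]mulrC [D ^+ 2 * _]mulrC !divfK ?expf_neq0.
Qed.

Lemma point_cases Q : Q = 0 \/ exists x y, at_xy Q x y.
Proof.
case e : (coords Q) => [[X Y]|]; last by left; apply: val_inj.
by right; exists (X / D), (Y / D ^+ 2); apply: at_xy_coords.
Qed.

Lemma at_xy_inj P Q x y : at_xy P x y -> at_xy Q x y -> P = Q.
Proof. by move=> hP hQ; apply: val_inj; rewrite /= hP hQ. Qed.

Lemma at_xyN Q x y : at_xy Q x y -> at_xy (- Q) x (- y).
Proof. by move=> e; rewrite /at_xy /= e /= mulrN. Qed.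

Lemma at_xy_double Q x y : at_xy Q x y ->
  exists y', at_xy (Q *+ 2) (dbl_num x 1 / dbl_den x 1) y'.
Proof.
move=> e; have y0 := at_xy_y_neq0 e; have ec := at_xy_cubic e.
have two0 := two_neq0 E.
have : coords (Q *+ 2) = add_coords E (coords Q) (coords Q) by rewrite mulr2n.
move: (Q *+ 2) => Q2.
rewrite e /= !eqxx /= a2E a4E.
have -> : (D ^+ 2 * y == - (D ^+ 2 * y)) = false.
  apply/eqP => h; have : D ^+ 2 * y * 2 = 0.
    by rewrite mulr_natr mulr2n {1}h addNr.
  by apply/eqP; rewrite !mulf_neq0 ?expf_neq0.
move=> /at_xy_coords; set x2 := (_ - D * x) / D.
have -> : x2 = dbl_num x 1 / dbl_den x 1.
  rewrite /x2 /dbl_den -ec dbl_numE -ec /cubic'; field.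
  by rewrite D0 y0 two0 (_ : 4 = 2 * 2 :> F) ?mulf_neq0 //; ring.
by eexists; eauto.
Qed.

Definition chord_x x1 y1 x2 y2 := D * ((y2 - y1) / (x2 - x1)) ^+ 2 - 2 - x1 - x2.

Lemma at_xyD P Q x1 y1 x2 y2 : at_xy P x1 y1 -> at_xy Q x2 y2 -> x1 != x2 ->
  exists y', at_xy (P + Q) (chord_x x1 y1 x2 y2) y'.
Proof.
move=> eP eQ x12.
have : coords (P + Q) = add_coords E (coords P) (coords Q) by [].
move: (P + Q) => S.
have hx : (D * x1 == D * x2) = false.
  by apply/negbTE; apply: contraNneq x12 => /(mulfI D0) ->.
rewrite eP eQ /= hx /= a2E.
move=> /at_xy_coords; set x3 := (_ - D * x2) / D.
have d0 : x2 - x1 != 0 by rewrite subr_eq0 eq_sym.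
have -> : x3 = chord_x x1 y1 x2 y2.
  by rewrite /x3 /chord_x; field; rewrite D0 d0 -mulrBr mulf_neq0.
by eexists; eauto.
Qed.

Section ChordIdentities.
Variables (x1 y1 x2 y2 : F).
Hypotheses (c1 : D * y1 ^+ 2 = cubic x1 1) (c2 : D * y2 ^+ 2 = cubic x2 1).
Hypothesis x12 : x1 != x2.

Let d0 : x2 - x1 != 0. Proof. by rewrite subr_eq0 eq_sym. Qed.
Let s2 : D * (y1 ^+ 2 + y2 ^+ 2) = cubic x1 1 + cubic x2 1.
Proof. by rewrite mulrDr c1 c2. Qed.
Let s := (2 + x1 + x2) * (x2 - x1) ^+ 2.

Lemma chord_x_sum :
  (chord_x x1 y1 x2 y2 + chord_x x1 y1 x2 (- y2)) * (x2 - x1) ^+ 2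
  = chord_sum x1 1 x2 1.
Proof.
transitivity (2 * (D * (y1 ^+ 2 + y2 ^+ 2)) - 2 * s).
  by rewrite /s /chord_x; field.
by rewrite s2 /s /cubic /chord_sum; ring.
Qed.

Lemma chord_x_prod :
  chord_x x1 y1 x2 y2 * chord_x x1 y1 x2 (- y2) * (x2 - x1) ^+ 2
  = chord_prod x1 1 x2 1.
Proof.
apply: (mulIf (expf_neq0 2 d0)).
transitivity ((D * y2 ^+ 2 - D * y1 ^+ 2) ^+ 2
    - 2 * s * (D * (y1 ^+ 2 + y2 ^+ 2)) + s ^+ 2).
  by rewrite /s /chord_x; field.
by rewrite s2 c1 c2 /s /cubic /chord_prod; ring.
Qed.

End ChordIdentities.

Lemma at_xy_same_x P Q x y1 y2 : at_xy P x y1 -> at_xy Q x y2 -> Q = P \/ Q = - P.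
Proof.
move=> e1 e2; have c1 := at_xy_cubic e1; have c2 := at_xy_cubic e2.
have : (y2 - y1) * (y2 + y1) = 0.
  apply: (mulfI D0); rewrite mulr0.
  transitivity (D * y2 ^+ 2 - D * y1 ^+ 2); first by ring.
  by rewrite c1 c2 subrr.
move=> /eqP; rewrite mulf_eq0 subr_eq0 addr_eq0 => /orP[] /eqP ey.
  by left; apply: (at_xy_inj e2); rewrite ey.
by right; apply: (at_xy_inj e2); rewrite ey; apply: at_xyN.
Qed.

End Twist.

(** Any function on x-coordinates with the right behaviour under duplication
    and chords gives a height on the points of the twist, satisfying the
    hypotheses of [height_of_multiple]. *)
Section PointHeight.
Variables (F : fieldType) (E : ellcurve F) (D : F).
Hypotheses (D0 : D != 0) (noroot : forall x : F, cubic x 1 != 0).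
Hypotheses (a2E : a2 E = 2 * D) (a4E : a4 E = 163 * D ^+ 2).
Hypothesis a6E : a6 E = 2205 * D ^+ 3.
Variables (R : realFieldType) (h : F -> R) (C c C' : R).
Hypotheses (C1 : 1 <= C) (c1 : 1 <= c) (C'1 : 1 <= C') (C'C : C' <= C).
Hypothesis h1 : forall x, 1 <= h x.
Hypothesis h_dbl_ge :
  forall x, cubic x 1 != 0 -> h x ^+ 4 <= c * h (dbl_num x 1 / dbl_den x 1).
Hypothesis h_dbl_le :
  forall x, cubic x 1 != 0 -> h (dbl_num x 1 / dbl_den x 1) <= C' * h x ^+ 4.
Hypothesis h_chord : forall x1 x2 x3 x4, x1 != x2 ->
  (x3 + x4) * (x2 - x1) ^+ 2 = chord_sum x1 1 x2 1 ->
  x3 * x4 * (x2 - x1) ^+ 2 = chord_prod x1 1 x2 1 ->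
  h x3 * h x4 <= C * (h x1 * h x2) ^+ 2.
Implicit Types (P Q : point E) (x y : F).

Local Notation at_xy := (@at_xy F E D).
Let cases Q : Q = 0 \/ exists x y, at_xy Q x y := point_cases D0 Q.

Definition point_height Q : R := if coords Q is Some (X, _) then h (X / D) else 1.

Lemma point_height0 : point_height 0 = 1. Proof. by []. Qed.

Lemma point_heightE Q x y : at_xy Q x y -> point_height Q = h x.
Proof. by move=> e; rewrite /point_height e mulrAC divff ?mul1r. Qed.

Lemma point_height_ge1 Q : 1 <= point_height Q.
Proof.
have [->|[x [y e]]] := cases Q; first by rewrite point_height0.
by rewrite (point_heightE e).
Qed.

Lemma point_heightN Q : point_height (- Q) = point_height Q.
Proof.
have [->|[x [y e]]] := cases Q; first by rewrite oppr0.
by rewrite (point_heightE e) (point_heightE (at_xyN e)).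
Qed.

Lemma point_height_dbl_ge Q : point_height Q ^+ 4 <= c * point_height (Q *+ 2).
Proof.
have [->|[x [y e]]] := cases Q; last first.
  have [y' e'] := at_xy_double D0 noroot a2E a4E a6E e.
  by rewrite (point_heightE e) (point_heightE e') h_dbl_ge.
by rewrite mul0rn point_height0 expr1n mulr1.
Qed.

Lemma point_height_dbl_le Q : point_height (Q *+ 2) <= C' * point_height Q ^+ 4.
Proof.
have [->|[x [y e]]] := cases Q; last first.
  have [y' e'] := at_xy_double D0 noroot a2E a4E a6E e.
  by rewrite (point_heightE e) (point_heightE e') h_dbl_le.
by rewrite mul0rn point_height0 expr1n mulr1.
Qed.

Lemma point_height_parallelogram P Q :
  point_height (P + Q) * point_height (P - Q) <=
  C * (point_height P * point_height Q) ^+ 2.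
Proof.
have hb (z : R) : 0 <= z -> z <= C * z by move=> z0; rewrite ler_peMl.
have [->|[x1 [y1 e1]]] := cases P.
  by rewrite add0r sub0r point_heightN point_height0 mul1r -expr2 hb // sqr_ge0.
have [->|[x2 [y2 e2]]] := cases Q.
  by rewrite addr0 subr0 point_height0 mulr1 -expr2 hb // sqr_ge0.
have [x12|x12] := eqVneq x1 x2; last first.
  have [y3 e3] := at_xyD D0 a2E e1 e2 x12.
  have [y4 e4] := at_xyD D0 a2E e1 (at_xyN e2) x12.
  rewrite (point_heightE e1) (point_heightE e2) (point_heightE e3) (point_heightE e4).
  have f1 := at_xy_cubic D0 a2E a4E a6E e1.
  have f2 := at_xy_cubic D0 a2E a4E a6E e2.
  exact: h_chord x12 (chord_x_sum f1 f2 x12) (chord_x_prod f1 f2 x12).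
have hdouble : point_height (P *+ 2) * 1 <= C * (point_height P * point_height P) ^+ 2.
  rewrite mulr1; apply: le_trans (point_height_dbl_le P) _.
  have -> : (point_height P * point_height P) ^+ 2 = point_height P ^+ 4 by ring.
  have : 0 <= point_height P ^+ 4.
    by rewrite exprn_ge0 // (le_trans _ (point_height_ge1 P)).
  by move=> p4; rewrite ler_wpM2r.
rewrite -x12 in e2.
have [->|->] := at_xy_same_x D0 a2E a4E a6E e1 e2.
  by rewrite subrr point_height0 -mulr2n.
by rewrite subrr opprK point_height0 point_heightN mulrC -mulr2n.
Qed.

End PointHeight.

(** With d = D, h = H(2Q) and p = H(m Q), the lower bound for H(2Q) is not
    compatible with [height_of_multiple]: 4498 is the integer part of
    10^7 / 2223, and 4498^3 exceeds 23 * 144 * 247^3. *)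
Lemma multiple_height_gap (R : realFieldType) (d h p : R) :
  1 <= p -> 1000 * 1000 * p <= d -> 10 * d <= 2223 * h ->
  (144 * 247 ^+ 3 < h ^+ 3 -> h ^+ 3 <= 144 * 247 ^+ 3 * (23 * p ^+ 3)) -> False.
Proof.
move=> p1 hd h2 hmul.
have hp : 4498 * p <= h by lra.
have p3 : 1 <= p ^+ 3 by rewrite exprn_ege1.
have hp3 : (4498 * p) ^+ 3 <= h ^+ 3 by apply: lerXn2r hp; rewrite nnegrE; lra.
rewrite exprMn in hp3.
have : 144 * 247 ^+ 3 < h ^+ 3 by lra.
by move=> /hmul; lra.
Qed.

Section Multiples.
Variables (R : archiRealFieldType) (D : int) (E : ellcurve rat).
Hypotheses (D0 : D%:~R != 0 :> rat) (sD : squarefree D).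
Hypotheses (a2E : a2 E = 2 * D%:~R) (a4E : a4 E = 163 * D%:~R ^+ 2).
Hypothesis a6E : a6 E = 2205 * D%:~R ^+ 3.
Implicit Types (P Q : point E).

Local Notation point_height := (@point_height rat E D%:~R R (rat_height R)).

Lemma point_height_dbl_twist Q : Q != 0 -> 10 * D%:~R <= 2223 * point_height (Q *+ 2).
Proof.
case: (point_cases D0 Q) => [-> /eqP []|[x [y e]] _]; first exact: erefl.
have [y' e'] := at_xy_double D0 cubic_rat_neq0 a2E a4E a6E e.
rewrite (point_heightE D0 _ e').
exact: rat_height_dbl_twist sD (at_xy_cubic D0 a2E a4E a6E e).
Qed.

(** No proper multiple of a nonzero point has height as small as 10^-6 D.
    For the given point this contradicts P = m Q; for the point at infinity it
    excludes torsion. *)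
Lemma point_height_multiple (n : int) Q (m : int) : 1000 * 1000 * n <= D ->
  Q != 0 -> 2 <= `|m| -> n%:~R < point_height (Q *~ m).
Proof.
move=> hn0.
have hn : 1000 * 1000 * n%:~R <= D%:~R :> R.
  by have -> : 1000 * 1000 * n%:~R = (1000 * 1000 * n)%:~R :> R; [ring|rewrite ler_int].
have C1 : 1 <= 6400 * 1000 :> R by lra.
have c1 : 1 <= 144 * 247 ^+ 3 :> R by lra.
have C'1 : 1 <= 23 :> R by lra.
have C'0 : 0 < 23 :> R by lra.
have C'C : 23 <= 6400 * 1000 :> R by lra.
have g1 := point_height_ge1 D0 (@rat_height_ge1 R).
move=> Q0 hm; rewrite ltNge; apply/negP => hp.
have h2 := point_height_dbl_twist Q0; have p1 := g1 E (Q *~ m).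
have hmul := height_of_multiple C1 c1 C'0 (g1 E) (point_heightN D0 (rat_height R))
  (point_height_parallelogram D0 cubic_rat_neq0 a2E a4E a6E C1 C'1 C'C
     (@rat_height_ge1 R) (@rat_height_dbl_le R)
     (@rat_height_chord R))
  (point_height_dbl_ge D0 cubic_rat_neq0 a2E a4E a6E c1 (@rat_height_dbl_ge R))
  (point_height_dbl_le D0 cubic_rat_neq0 a2E a4E a6E C'1 (@rat_height_dbl_le R)) hm.
apply: multiple_height_gap p1 _ h2 (hmul Q).
apply: le_trans hn; apply: ler_wpM2l hp; lra.
Qed.

End Multiples.

(** * The point P and the size of D *)

(** The quotient of the two polynomials is close to u = t^2, and
    u >= 2216^2 > 4 * 10^6 leaves ample room for the lower order terms. *)
Lemma sextic_large (R : realDomainType) (t : R) : 2216 <= `|t| ->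
  let n := t ^+ 4 + 2 * t ^+ 2 + 12 * t in
  10 <= n /\ 1000 * 1000 * n <=
    t ^+ 6 + 4 * t ^+ 4 + 30 * t ^+ 3 + 5 * t ^+ 2 + 54 * t + 245.
Proof.
move=> ht; set u : R := t ^+ 2.
have eu : u = `|t| ^+ 2 by rewrite /u real_normK ?num_real.
have hu : 4 * (1000 * 1000) <= u by rewrite eu; nra.
have [t1 t2] : - u <= t /\ t <= u.
  by apply/andP; rewrite -ler_norml eu; nra.
have u0 : 0 <= u by lra.
have a1 : 4 * (1000 * 1000) * u <= u * u by rewrite ler_wpM2r.
have a2 : 4 * (1000 * 1000) * (u * u) <= u * (u * u).
  by apply: ler_wpM2r hu; rewrite mulr_ge0.
have a3 : - (u * u) <= u * t by rewrite -mulrN ler_wpM2l.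
have -> : t ^+ 6 = u * (u * u) by rewrite /u; ring.
have -> : t ^+ 4 = u * u by rewrite /u; ring.
have -> : t ^+ 3 = u * t by rewrite /u; ring.
by split; lra.
Qed.

Lemma Dpoly_large (t : int) : 2216 <= `|t| ->
  let n := t ^+ 4 + 2 * t ^+ 2 + 12 * t in 10 <= n /\ 1000 * 1000 * n <= Dpoly t.
Proof. exact: sextic_large. Qed.

Lemma point_height_PD (R : archiRealFieldType) (t : int) :
  let n := t ^+ 4 + 2 * t ^+ 2 + 12 * t in 10 <= n ->
  point_height (Dpoly t)%:~R (rat_height R) (PD t) = n%:~R.
Proof.
move=> n n10.
have e : at_xy (Dpoly t)%:~R (PD t) n%:~R (t ^+ 3 + t + 3)%:~R.
  by rewrite /at_xy /= /n; congr (Some (_ * _, _ * _)); ring.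
rewrite (point_heightE (DpolyQ_neq0 t) _ e) /rat_height numq_int denq_int mulr1.
have h : 10 <= n%:~R :> R by rewrite -(ler_int R) in n10.
by rewrite ger0_norm ?(le_trans _ h) //; apply/max_idPl.
Qed.

(** * Primitive elements in rank one *)

(** A relation a P + b Q = 0 can be taken with a and b coprime, as there is no
    torsion; then P = b (w P - u Q) by Bezout, and primitivity forces
    b = 1 or -1. *)
Lemma primitive_generates_rank1 (A : zmodType) (P : A) :
  (forall (Q : A) (m : int), Q *~ m = 0 -> Q = 0 \/ m = 0) ->
  has_rank A 1 -> primitive P -> forall Q, generated P Q.
Proof.
move=> tf [_ rk] prP Q; apply/generatedP.
have P0 : P <> 0 by move=> P0; apply: prP; exists 0, 2; rewrite mul0rz.
pose v (i : 'I_2) := if i == ord0 then P else Q.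
have : ~ zindep v by move=> /rk.
move=> nind; apply: Classical_Prop.NNPP => nQ; apply: nind => c.
rewrite big_ord_recl big_ord1 /v /= => ec.
set a := c ord0 in ec; set b := c (lift ord0 ord0) in ec.
suff [a0 b0] : a = 0 /\ b = 0.
  by move=> i; case: (unliftP ord0 i) => [j|] ->; rewrite ?[j]ord1.
have [b0|b0] := eqVneq b 0.
  by move: ec; rewrite b0 mulr0z addr0 => /tf[].
exfalso; apply: nQ.
have [u [w e]] := Bezoutz a b.
set g := gcdz a b in e.
have g0 : g != 0 by rewrite gcdz_eq0 negb_and b0 orbT.
have [a' ea] : exists a', a = a' * g by apply/dvdzP/dvdz_gcdl.
have [b' eb] : exists b', b = b' * g by apply/dvdzP/dvdz_gcdr.
have e1 : u * a' + w * b' = 1.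
  apply: (mulIf g0); rewrite mul1r; transitivity (u * (a' * g) + w * (b' * g)).
    by ring.
  by rewrite -ea -eb.
have ec' : P *~ a' + Q *~ b' = 0.
  have : (P *~ a' + Q *~ b') *~ g = 0.
    by rewrite mulrzDl -!mulrzA -ea -eb.
  by case/tf => // /eqP; rewrite (negbTE g0).
pose S := P *~ w - Q *~ u.
have eQ : Q *~ b' = - (P *~ a') by apply/eqP; rewrite -addr_eq0 addrC ec'.
have eP : P = S *~ b'.
  rewrite /S mulrzBl -!mulrzA [u * b']mulrC [Q *~ (b' * u)]mulrzA eQ mulNrz opprK.
  by rewrite -mulrzA -mulrzDr [a' * u]mulrC addrC e1 mulr1z.
have hb : `|b'| = 1.
  have b'0 : b' != 0 by apply: contraNneq b0 => b'0; rewrite eb b'0 mul0r.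
  have [h|h] := leP 2 `|b'|; last by lia.
  by case: prP; exists S, b'.
exists (- (a' * b')); have bb : b' * b' = 1 by nia.
by rewrite -[LHS]mulr1z -bb mulrzA eQ mulNrz -mulrzA mulrNz.
Qed.

(** * The theorem *)

Theorem theorem1p3 (t : int) (hD : squarefree (Dpoly t)) (ht : 2216 <= `|t|) :
  primitive (PD t) /\
  (has_rank (point (ED t)) 1 ->
   isomorphic_to_subgroup (point (ED t)) (generated (PD t))).
Proof.
have [n10 nD] := Dpoly_large ht; set n := t ^+ 4 + 2 * t ^+ 2 + 12 * t in n10 nD.
have big (P Q : point (ED t)) m :
    point_height (Dpoly t)%:~R (rat_height rat) P <= n%:~R ->
    2 <= `|m| -> P = Q *~ m ->
    Q = 0.
  move=> hP hm eP; have [//|Q0] := eqVneq Q 0.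
  have := @point_height_multiple rat (Dpoly t) (ED t) (DpolyQ_neq0 t) hD
    erefl erefl erefl n Q m nD Q0 hm.
  by rewrite -eP ltNge hP.
have prP : primitive (PD t).
  move=> [Q [m [hm eP]]].
  have hP : point_height (Dpoly t)%:~R (rat_height rat) (PD t) = n%:~R.
    by apply: point_height_PD.
  have Q0 : Q = 0 by apply: (big _ _ _ _ hm eP); rewrite hP.
  by have := congr1 (@coords _ _) eP; rewrite Q0 mul0rz.
split=> // rk.
have gen : forall Q, generated (PD t) Q.
  apply: primitive_generates_rank1 => // Q m eQ.
  have [->|m0] := eqVneq m 0; [by right|left].
  (* Doubling m makes its absolute value at least 2. *)
  apply: (big 0 Q (m * 2)); rewrite ?mulrzA ?eQ ?mul0rz //; last by lia.
  by rewrite point_height0 ler1z; lia.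
by exists idfun; split=> // Q; split=> [_|_]; [exists Q|exact: gen].
Qed.
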